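(* Every projective variety $V$ over $K$ is isomorphic to $\mathfrak{ModuliMax}^T_{\mathbf d}$ for some choice of a finite dimensional algebra $\Lambda=KQ/I$ ($Q$ a quiver, $I$ an admissible ideal of $KQ$), a finite dimensional semisimple $\Lambda$-module $T$, and a dimension vector $\mathbf d$.
   Context: $K$ is an algebraically closed field. For a basic finite dimensional $K$-algebra $\Lambda=KQ/I$ with Jacobson radical $J$ and primitive idempotents $e_1,\dots,e_n$ (vertices of $Q$), let $S_i=\Lambda e_i/Je_i$, $T=\bigoplus_i S_i^{t_i}$, $t=\sum_i t_i$, and let $P=\bigoplus_{r=1}^t\Lambda z_r$ be a projective cover of $T$, with $z_r=e(r)z_r$, $e(r)\in\{e_1,\dots,e_n\}$, $\Lambda z_r\cong\Lambda e(r)$, ordered so that the first $t_1$ of the $z_r$ satisfy $z_r=e_1z_r$, the next $t_2$ satisfy $z_r=e_2z_r$, etc. $\mathfrak{Grass}^T_{\mathbf d}$ is the closed subvariety of the Grassmannian $\mathrm{Gr}(\dim P-|\mathbf d|,P)$ (with $|\mathbf d|$ the sum of entries of $\mathbf d$) consisting of those subspaces $C$ that are $\Lambda$-submodules of $JP$ with $P/C$ of dimension vector $\mathbf d$; $\mathrm{Aut}_\Lambda(P)$ acts on it. $\mathrm{Aut}_\Lambda(T)$ is identified with the group of automorphisms of $P$ leaving $\bigoplus_r Kz_r$ invariant, i.e. with $\prod_i\mathrm{GL}(V_i)$, where $V_i$ is the span of the $z_r$ with $z_r=e_iz_r$; $\mathcal B=\prod_i B_i$ with $B_i\subseteq\mathrm{GL}(V_i)$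 the upper triangular group relative to the ordered basis of the $z_r$ in $V_i$; $\mathrm{Aut}_\Lambda(P)_u=\{\mathrm{id}_P+f\mid f\in\mathrm{Hom}_\Lambda(P,JP)\}$ is the unipotent radical of $\mathrm{Aut}_\Lambda(P)$. Then $\mathfrak{ModuliMax}^T_{\mathbf d}=\{C\in\mathfrak{Grass}^T_{\mathbf d}\mid\mathcal B\ltimes\mathrm{Aut}_\Lambda(P)_u\subseteq\mathrm{Stab}_{\mathrm{Aut}_\Lambda(P)}(C)\}$, a closed subvariety of $\mathfrak{Grass}^T_{\mathbf d}$; it is a fine moduli space for the modules of dimension vector $\mathbf d$ that have top $T$ and have no proper degeneration with top $T$. *)

(* Defs.v *)
From HB Require Import structures.
From mathcomp Require Import all_boot all_order all_algebra all_field.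
From mathcomp Require Import finmap mpoly.

Set Implicit Arguments.
Unset Strict Implicit.
Unset Printing Implicit Defensive.

Import GRing.Theory.
Local Open Scope ring_scope.

(* Points of P^(n-1) are the lines <[x]>, x != 0, of K^n. *)
Section Projective.
Variable K : fieldType.

Definition meval_row n (p : {mpoly K[n]}) (x : 'rV[K]_n) : K := p.@[x ord0].

(* The common zeros of a set of homogeneous polynomials; neither irreducible nor
   nonempty in general. *)
Definition projective_variety n (V : {vspace 'rV[K]_n} -> Prop) : Prop :=
  exists S : {mpoly K[n]} -> Prop,
    (forall p, S p -> exists D, p \is D.-homog) /\
    forall l, V l <->
      exists x : 'rV[K]_n, [/\ x != 0, l = <[x]>%VS
                             & forall p, S p -> meval_row p x = 0].

Definition poly_map n m (F : 'I_m -> {mpoly K[n]}) (x : 'rV[K]_n) : 'rV[K]_m :=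
  \row_j meval_row (F j) x.

(* Locally on X, f is given by homogeneous polynomials of the same degree. *)
Definition regular_map n m (X : {vspace 'rV[K]_n} -> Prop)
    (f : {vspace 'rV[K]_n} -> {vspace 'rV[K]_m}) : Prop :=
  forall x : 'rV[K]_n, x != 0 -> X <[x]>%VS ->
  exists (D : nat) (F : 'I_m -> {mpoly K[n]}),
    [/\ forall j, F j \is D.-homog, poly_map F x != 0
      & forall y : 'rV[K]_n, y != 0 -> X <[y]>%VS -> poly_map F y != 0 ->
          f <[y]>%VS = <[poly_map F y]>%VS].

Definition variety_iso n m (X : {vspace 'rV[K]_n} -> Prop)
    (Y : {vspace 'rV[K]_m} -> Prop) : Prop :=
  exists (f : {vspace 'rV[K]_n} -> {vspace 'rV[K]_m})
         (g : {vspace 'rV[K]_m} -> {vspace 'rV[K]_n}),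
    [/\ (forall l, X l -> Y (f l)) /\ (forall l, Y l -> X (g l)),
        (forall l, X l -> g (f l) = l) /\ (forall l, Y l -> f (g l) = l),
        regular_map X f & regular_map Y g].

Definition incr_fun (k N : nat) : Type :=
  {s : {ffun 'I_k -> 'I_N} | [forall i : 'I_k, forall j : 'I_k, (i < j)%N ==> (s i < s j)%N]}.
HB.instance Definition _ k N := Finite.on (incr_fun k N).

Variable W : vectType K.

(* The maximal minors of the k x (dim W) matrix of a basis of C, in increasing
   column order; they depend on the chosen basis only up to a common factor. *)
Definition pluecker_coord (k : nat) (C : {vspace W}) (s : incr_fun k (\dim {: W})) : K :=
  \det (\matrix_(i < k, j < k) coord (vbasis {: W}) (val s j) (vbasis C)`_i).

Definition pluecker_pt (k : nat) (C : {vspace W}) :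
    {vspace 'rV[K]_#|{: incr_fun k (\dim {: W})}|} :=
  <[\row_j pluecker_coord C (enum_val j)]>%VS.

(* A set X of k-dimensional subspaces of W, as a set of points of projective
   space via the Pluecker embedding of Gr(k, W). *)
Definition pluecker_image (k : nat) (X : {vspace W} -> Prop) :
    {vspace 'rV[K]_#|{: incr_fun k (\dim {: W})}|} -> Prop :=
  fun l => exists C, [/\ X C, \dim C = k & l = pluecker_pt k C].

End Projective.
Arguments pluecker_image {K W} k X _.

(* Only from here on, as it redefines {mpoly R[n]}. *)
From mathcomp Require Import monalg.

(* A finite quiver with vertices 0, ..., qvert; there is at least one vertex,
   so that the path algebra is a nonzero ring. *)
Record quiver := Quiver {
  qvert : nat;
  qarr  : finType;
  qsrc  : qarr -> 'I_qvert.+1;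
  qtgt  : qarr -> 'I_qvert.+1
}.

Section QPath.
Variable Q : quiver.
Local Notation vertex := ('I_(qvert Q).+1).

Fixpoint qwalk (i : vertex) (s : seq (qarr Q)) : bool :=
  if s is a :: s' then (qsrc a == i) && qwalk (qtgt a) s' else true.

(* A path is a start vertex together with the arrows in the order in which
   they are traversed; (i, [::]) is the path of length 0 at i. *)
Definition qpath : Type := {x : vertex * seq (qarr Q) | qwalk x.1 x.2}.
HB.instance Definition _ := Choice.on qpath.

Definition qstart (p : qpath) : vertex := (val p).1.
Definition qarrows (p : qpath) : seq (qarr Q) := (val p).2.
Definition qend (p : qpath) : vertex := last (qstart p) (map (@qtgt Q) (qarrows p)).
Definition qlen (p : qpath) : nat := size (qarrows p).

Definition qtriv (i : vertex) : qpath := exist _ (i, [::]) isT.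

Lemma qwalk_cat i s1 s2 :
  qwalk i (s1 ++ s2) = qwalk i s1 && qwalk (last i (map (@qtgt Q) s1)) s2.
Proof. by elim: s1 i => //= a s1 IH i; rewrite IH andbA. Qed.

Lemma qcomp_subproof (p q : qpath) : qend q = qstart p ->
  qwalk (qstart q) (qarrows q ++ qarrows p).
Proof.
move=> h; rewrite qwalk_cat -/(qend q) h.
by apply/andP; split; [exact: (valP q) | exact: (valP p)].
Qed.

(* pq is "first q, then p"; None stands for the zero product. *)
Definition qcomp (p q : qpath) : option qpath :=
  match eqVneq (qend q) (qstart p) with
  | EqNotNeq h => Some (exist _ (qstart q, qarrows q ++ qarrows p) (qcomp_subproof h))
  | NeqNotEq _ => None
  end.

Lemma qcompE p q : omap val (qcomp p q) =
  if qend q == qstart p then Some (qstart q, qarrows q ++ qarrows p) else None.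
Proof. by rewrite /qcomp; case: eqVneq. Qed.

Lemma qcomp_triv p i : qcomp p (qtriv i) = if i == qstart p then Some p else None.
Proof.
apply: (inj_omap val_inj); rewrite qcompE /qend /=.
by case: eqP => // -> /=; rewrite -surjective_pairing.
Qed.

Lemma qcomp_trivl p i : qcomp (qtriv i) p = if qend p == i then Some p else None.
Proof.
apply: (inj_omap val_inj); rewrite qcompE /=.
by case: eqP => //= _; rewrite cats0 -surjective_pairing.
Qed.

Lemma qcompA p q r :
  obind (qcomp p) (qcomp q r) = obind (fun s => qcomp s r) (qcomp p q).
Proof.
have valE (o : option qpath) w x : omap val o = Some (w, x) ->
    exists s, [/\ o = Some s, qstart s = w & qarrows s = x].
  by case: o => //= s [E]; exists s; rewrite /qstart /qarrows [val s]E.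
have noneE (o : option qpath) : omap val o = None -> o = None by case: o.
apply: (inj_omap val_inj).
move: (qcompE q r) (qcompE p q).
case: eqP => hqr; case: eqP => hpq.
- move=> /valE [s [-> s1 s2]] /valE [u [-> u1 u2]] /=.
  rewrite !qcompE {1}/qend s1 s2 u1 u2 hqr eqxx catA.
  by rewrite map_cat last_cat -/(qend r) hqr -/(qend q) hpq eqxx.
- move=> /valE [s [-> s1 s2]] /noneE -> /=.
  rewrite qcompE {1}/qend s1 s2 map_cat last_cat -/(qend r) hqr -/(qend q).
  by case: eqP.
- move=> /noneE -> /valE [u [-> u1 u2]] /=.
  by rewrite qcompE u1; case: eqP.
- by move=> /noneE -> /noneE ->.
Qed.

End QPath.

Definition path_algebra (K : fieldType) (Q : quiver) : Type := {malg K[qpath Q]}.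
HB.instance Definition _ K Q := GRing.Lmodule.on (path_algebra K Q).

HB.lock Definition qterm (K : fieldType) (Q : quiver) (c : K) (o : option (qpath Q)) : path_algebra K Q :=
  if o is Some p then mkmalgU p c else 0.

HB.lock Definition qmul (K : fieldType) (Q : quiver) (x y : path_algebra K Q) : path_algebra K Q :=
  \sum_(p <- monalg.msupp x) \sum_(q <- monalg.msupp y)
    qterm (monalg.mcoeff p x * monalg.mcoeff q y) (qcomp p q).

Section PathAlgebra.
Variables (K : fieldType) (Q : quiver).
Local Notation path := (qpath Q).
Local Notation path_algebra := (path_algebra K Q).
Local Notation qmul := (@qmul K Q).
Local Notation qterm := (@qterm K Q).

Implicit Types x y z : path_algebra.
Local Notation supp := (@monalg.msupp path K).
Local Notation coef x p := (@monalg.mcoeff path K p x).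

Definition qpath_elt (p : path) : path_algebra := qterm 1 (Some p).

Definition qone : path_algebra := \sum_(i < (qvert Q).+1) qpath_elt (qtriv i).

Lemma qcoefZ c x p : coef (c *: x) p = c * coef x p.
Proof. exact: mcoeffZ. Qed.

Lemma qcoefT c p q : coef (qterm c (Some p)) q = c *+ (p == q).
Proof. by rewrite qterm.unlock; exact: mcoeffU. Qed.

Lemma qtermN c : qterm c None = 0.
Proof. by rewrite qterm.unlock. Qed.

Lemma qterm0 o : qterm 0 o = 0.
Proof. by rewrite qterm.unlock; case: o => //= p; rewrite monalgU0. Qed.

Lemma qtermD c1 c2 o : qterm (c1 + c2) o = qterm c1 o + qterm c2 o.
Proof. by rewrite qterm.unlock; case: o => /= [p|]; rewrite ?addr0 ?monalgUD. Qed.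

Lemma qtermZ c1 c2 o : qterm (c1 * c2) o = c1 *: qterm c2 o.
Proof.
case: o => [p|]; last by rewrite qterm.unlock scaler0.
by apply/malgP => k; rewrite qcoefT qcoefZ qcoefT mulrnAr.
Qed.

Lemma qmulw (d1 d2 : {fset path}) x y :
  (supp x `<=` d1)%fset -> (supp y `<=` d2)%fset ->
  qmul x y = \sum_(p <- d1) \sum_(q <- d2) qterm (coef x p * coef y q) (qcomp p q).
Proof.
move=> le_d1 le_d2; rewrite qmul.unlock (big_fset_incl _ le_d1) /=.
  apply/eq_bigr => p _; apply/big_fset_incl => // q _ /mcoeff_outdom ->.
  by rewrite mulr0 qterm0.
move=> p _ /mcoeff_outdom xp.
by rewrite big1 // => q _; rewrite xp mul0r qterm0.
Qed.

Lemma qmulDl : left_distributive qmul +%R.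
Proof.
move=> x y z; set d := (supp x `|` supp y)%fset.
rewrite (@qmulw d (supp z) (x + y)) ?msuppD_le ?fsubset_refl //.
rewrite (@qmulw d (supp z) x) ?fsubsetUl ?fsubset_refl //.
rewrite (@qmulw d (supp z) y) ?fsubsetUr ?fsubset_refl //.
rewrite -big_split; apply: eq_bigr => p _ /=.
rewrite -big_split; apply: eq_bigr => q _ /=.
by rewrite mcoeffD mulrDl qtermD.
Qed.

Lemma qmulDr : right_distributive qmul +%R.
Proof.
move=> z x y; set d := (supp x `|` supp y)%fset.
rewrite (@qmulw (supp z) d z (x + y)) ?msuppD_le ?fsubset_refl //.
rewrite (@qmulw (supp z) d z x) ?fsubsetUl ?fsubset_refl //.
rewrite (@qmulw (supp z) d z y) ?fsubsetUr ?fsubset_refl //.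
rewrite -big_split; apply: eq_bigr => p _ /=.
rewrite -big_split; apply: eq_bigr => q _ /=.
by rewrite mcoeffD mulrDr qtermD.
Qed.

Lemma qmul0l y : qmul 0 y = 0.
Proof. by apply: (addrI (qmul 0 y)); rewrite -qmulDl !addr0. Qed.

Lemma qmul0r x : qmul x 0 = 0.
Proof. by apply: (addrI (qmul x 0)); rewrite -qmulDr !addr0. Qed.

Lemma qmulZl c x y : c *: qmul x y = qmul (c *: x) y.
Proof.
rewrite (@qmulw (supp x) (supp y) (c *: x)) ?msuppZ_le ?fsubset_refl //.
rewrite (@qmulw (supp x) (supp y) x y) ?fsubset_refl //.
rewrite scaler_sumr; apply: eq_bigr => p _.
rewrite scaler_sumr; apply: eq_bigr => q _.
by rewrite qcoefZ -qtermZ mulrA.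
Qed.

Lemma qmulZr c x y : c *: qmul x y = qmul x (c *: y).
Proof.
rewrite (@qmulw (supp x) (supp y) x (c *: y)) ?msuppZ_le ?fsubset_refl //.
rewrite (@qmulw (supp x) (supp y) x y) ?fsubset_refl //.
rewrite scaler_sumr; apply: eq_bigr => p _.
rewrite scaler_sumr; apply: eq_bigr => q _.
by rewrite qcoefZ -qtermZ mulrCA.
Qed.

Lemma qmulUU p q c1 c2 :
  qmul (qterm c1 (Some p)) (qterm c2 (Some q)) = qterm (c1 * c2) (qcomp p q).
Proof.
rewrite {1 2}qterm.unlock (qmulw msuppU_le msuppU_le) !big_seq_fset1.
by rewrite !mcoeffUU.
Qed.

Lemma qalg_ind (P : path_algebra -> Prop) :
  P 0 -> (forall x y, P x -> P y -> P (x + y)) ->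
  (forall c p, P (qterm c (Some p))) -> forall x, P x.
Proof.
move=> P0 PD PU x.
have -> : x = \sum_(p <- supp x) qterm (coef x p) (Some p).
  by rewrite qterm.unlock; exact: monalgE.
exact: (big_ind P).
Qed.

Lemma qmulA : associative qmul.
Proof.
move=> x y z.
elim/qalg_ind: x => [|x1 x2 IH1 IH2|c1 p]; first by rewrite !qmul0l.
  by rewrite !qmulDl IH1 IH2.
elim/qalg_ind: y => [|y1 y2 IH1 IH2|c2 q]; first by rewrite qmul0r qmul0l qmul0r.
  rewrite (qmulDl y1 y2 z) (qmulDr _ (qmul y1 z)) (qmulDr _ y1 y2).
  by rewrite (qmulDl (qmul _ y1)) IH1 IH2.
elim/qalg_ind: z => [|z1 z2 IH1 IH2|c3 r]; first by rewrite !qmul0r.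
  by rewrite (qmulDr _ z1 z2) (qmulDr _ (qmul _ z1)) (qmulDr _ z1 z2) IH1 IH2.
rewrite (qmulUU q) (qmulUU p); have := qcompA p q r.
case: (qcomp q r) => [s|]; case: (qcomp p q) => [u|] h.
- by rewrite !qmulUU mulrA; congr qterm.
- by rewrite qmulUU [qcomp p s]h !qtermN qmul0l.
- by rewrite qmulUU -[qcomp u r]h !qtermN qmul0r.
- by rewrite !qtermN qmul0l qmul0r.
Qed.

Lemma qmul_suml (r : seq 'I_(qvert Q).+1) (F : 'I_(qvert Q).+1 -> path_algebra) y :
  qmul (\sum_(i <- r) F i) y = \sum_(i <- r) qmul (F i) y.
Proof. exact: (big_morph (qmul^~ y) (fun a b => qmulDl a b y) (qmul0l y)). Qed.

Lemma qmul_sumr (r : seq 'I_(qvert Q).+1) (F : 'I_(qvert Q).+1 -> path_algebra) x :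
  qmul x (\sum_(i <- r) F i) = \sum_(i <- r) qmul x (F i).
Proof. exact: (big_morph (qmul x) (qmulDr x) (qmul0r x)). Qed.

Lemma qmul1l : left_id qone qmul.
Proof.
elim/qalg_ind => [|x y IH1 IH2|c p]; first exact: qmul0r.
  by rewrite qmulDr IH1 IH2.
rewrite qmul_suml (bigD1 (qend p)) //= qmulUU qcomp_trivl eqxx mul1r big1 ?addr0 //.
by move=> i ip; rewrite qmulUU qcomp_trivl eq_sym (negPf ip) qtermN.
Qed.

Lemma qmul1r : right_id qone qmul.
Proof.
elim/qalg_ind => [|x y IH1 IH2|c p]; first exact: qmul0l.
  by rewrite qmulDl IH1 IH2.
rewrite qmul_sumr (bigD1 (qstart p)) //= qmulUU qcomp_triv eqxx mulr1 big1 ?addr0 //.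
by move=> i ip; rewrite qmulUU qcomp_triv (negPf ip) qtermN.
Qed.

Lemma qone_neq0 : qone != 0.
Proof.
apply/eqP => /(congr1 (fun x : path_algebra => coef x (qtriv ord0))).
rewrite /qone raddf_sum (bigD1 ord0) //= qcoefT eqxx big1; last first.
  move=> i i0; rewrite qcoefT; case: eqP => // /(congr1 (@qstart Q)) /eqP.
  by rewrite (negPf i0).
by rewrite addr0 mcoeff0 => /eqP; rewrite oner_eq0.
Qed.

HB.instance Definition _ := GRing.Zmodule_isNzRing.Build path_algebra
  qmulA qmul1l qmul1r qmulDl qmulDr qone_neq0.
HB.instance Definition _ := GRing.Lmodule_isLalgebra.Build K path_algebra qmulZl.
HB.instance Definition _ := GRing.Lalgebra_isAlgebra.Build K path_algebra qmulZr.

Definition two_sided_ideal (I : path_algebra -> Prop) : Prop :=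
  [/\ I 0, forall x y, I x -> I y -> I (x + y)
    & forall a x b, I x -> I (a * x * b)].

(* The m-th power of the arrow ideal: the K-span of the paths of length >= m. *)
Definition arrow_ideal_pow (m : nat) (x : path_algebra) : Prop :=
  forall p : path, p \in supp x -> (m <= qlen p)%N.

Definition admissible_ideal (I : path_algebra -> Prop) : Prop :=
  [/\ two_sided_ideal I,
      forall x, I x -> arrow_ideal_pow 2 x
    & exists m, forall x, arrow_ideal_pow m x -> I x].

(* phi exhibits L as the quotient algebra KQ/I. *)
Definition presents (I : path_algebra -> Prop) (L : algType K)
    (phi : {lrmorphism path_algebra -> L}) : Prop :=
  (forall a, exists x, phi x = a) /\ (forall x, phi x = 0 <-> I x).

End PathAlgebra.

Section Algebra.
Variables (K : fieldType) (L : falgType K).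

Definition left_ideal (M : {vspace L}) : Prop :=
  forall a x, x \in M -> a * x \in M.

Definition maximal_left_ideal (M : {vspace L}) : Prop :=
  [/\ left_ideal M, M <> fullv
    & forall N, left_ideal N -> (M <= N)%VS -> N = M \/ N = fullv].

Definition jacobson_radical (x : L) : Prop :=
  forall M, maximal_left_ideal M -> x \in M.

End Algebra.

Section ModuliMax.
Variables (K : fieldType) (L : falgType K) (n : nat) (e : 'I_n -> L).
(* t gives the multiplicities of T = (+)_i S_i^(t i), d the dimension vector. *)
Variables (t d : 'I_n -> nat).

(* The index (i, k) stands for the k-th of the elements z_r with e(r) = e_i. *)
Definition zidx : Type := {i : 'I_n & 'I_(t i)}.
HB.instance Definition _ := Finite.on zidx.

Definition zmul (u : {ffun zidx -> L}) : {ffun zidx -> L} :=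
  [ffun r => u r * e (tag r)].

Lemma zmul_linear : linear zmul.
Proof. by move=> c x y; apply/ffunP => r; rewrite !ffunE mulrDl scalerAl. Qed.
HB.instance Definition _ :=
  GRing.isLinear.Build K {ffun zidx -> L} {ffun zidx -> L} *:%R zmul zmul_linear.

(* P = (+)_r L e(r), inside the free left module L^r. *)
Definition projT_space : {vspace {ffun zidx -> L}} := limg (linfun zmul).

Lemma mem_projT_space (u : {ffun zidx -> L}) :
  reflect (forall r, exists a, u r = a * e (tag r)) (u \in projT_space).
Proof.
apply: (iffP memv_imgP) => [[x _ ->] r|h].
  by exists (x r); rewrite lfunE ffunE.
have h' r : exists a, u r == a * e (tag r) by have [a ->] := h r; exists a.
exists [ffun r => xchoose (h' r)]; rewrite ?memvf // lfunE /=.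
by apply/ffunP => r; rewrite !ffunE; apply/eqP/(xchooseP (h' r)).
Qed.

Definition projT : Type := subvs_of projT_space.
HB.instance Definition _ := Vector.on projT.

(* The vsproj in lact and zgen only retypes an element of projT_space. *)
Definition lact (a : L) (x : projT) : projT :=
  vsproj projT_space [ffun r => a * vsval x r].

Lemma lactE a x r : vsval (lact a x) r = a * vsval x r.
Proof.
rewrite /lact vsprojK ?ffunE //; apply/mem_projT_space => s; rewrite ffunE.
by have /mem_projT_space/(_ s)[b ->] := subvsP x; exists (a * b); rewrite mulrA.
Qed.

Lemma lact_linear a : linear (lact a).
Proof.
move=> c x y; apply: val_inj; apply/ffunP => r /=.
by rewrite !ffunE !lactE /= !ffunE mulrDr scalerAr.
Qed.
HB.instance Definition _ a :=
  GRing.isLinear.Build K projT projT *:%R (lact a) (lact_linear a).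

Definition zgen (i : 'I_n) (k : 'I_(t i)) : projT :=
  vsproj projT_space [ffun r => if r == Tagged (fun i => 'I_(t i)) k then e i else 0].

Lemma zgenE i k r :
  vsval (@zgen i k) r = if r == Tagged (fun i => 'I_(t i)) k then e i else 0.
Proof.
rewrite /zgen vsprojK ?ffunE //; apply/mem_projT_space => s; rewrite ffunE.
by case: eqP => [->|_]; [exists 1; rewrite mul1r | exists 0; rewrite mul0r].
Qed.

Definition rad_projT (x : projT) : Prop :=
  exists s : seq (L * projT),
    (forall u, u \in s -> jacobson_radical u.1) /\
    x = \sum_(u <- s) lact u.1 u.2.

Definition module_hom (f : 'End(projT)) : Prop :=
  forall a x, f (lact a x) = lact a (f x).

Definition aut_projT (g : 'End(projT)) : Prop :=
  module_hom g /\ lker g == 0%VS.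

(* Aut_L(P)_u *)
Definition aut_unip (g : 'End(projT)) : Prop :=
  exists f : 'End(projT),
    [/\ module_hom f, forall x, rad_projT (f x) & g = (\1 + f)%VF].

Definition zspan : {vspace projT} :=
  (\sum_(i < n) \sum_(k < t i) <[zgen k]>)%VS.

(* Aut_L(T), as the automorphisms of P leaving (+)_r K z_r invariant. *)
Definition aut_top (g : 'End(projT)) : Prop :=
  aut_projT g /\ (g @: zspan)%VS = zspan.

(* The product of the upper triangular groups B_i: the image of the k-th basis
   vector of V_i is a combination of the first k basis vectors of V_i. *)
Definition borel (g : 'End(projT)) : Prop :=
  aut_top g /\
  forall (i : 'I_n) (k : 'I_(t i)),
    g (zgen k) \in (\sum_(l < t i | (l <= k)%N) <[zgen l]>)%VS.

Definition borel_unip (g : 'End(projT)) : Prop :=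
  exists b u : 'End(projT), [/\ borel b, aut_unip u & g = (b \o u)%VF].

Definition stab (C : {vspace projT}) (g : 'End(projT)) : Prop :=
  aut_projT g /\ (g @: C)%VS = C.

Definition submodule (C : {vspace projT}) : Prop :=
  forall a x, x \in C -> lact a x \in C.

(* The dimension of e_i (P/C) = (e_i P + C)/C is d i. *)
Definition quotient_dimvec (C : {vspace projT}) : Prop :=
  forall i, \dim (limg (linfun (lact (e i))) + C) = (d i + \dim C)%N.

Definition grassT (C : {vspace projT}) : Prop :=
  [/\ (\dim C + \sum_i d i = \dim {: projT})%N,
      submodule C, forall x, x \in C -> rad_projT x
    & quotient_dimvec C].

Definition moduli_max (C : {vspace projT}) : Prop :=
  grassT C /\ forall g, borel_unip g -> stab C g.

End ModuliMax.
Arguments moduli_max {K L n} e t d _.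

(* Main.v *)
From HB Require Import structures.
From Stdlib Require Import Classical FunctionalExtensionality.
Require Import Defs.
From mathcomp Require Import all_boot all_order all_algebra all_field.
From mathcomp Require Import finmap mpoly ring.
From mathcomp Require monalg.

Set Implicit Arguments.
Unset Strict Implicit.
Unset Printing Implicit Defensive.

Import Order.TTheory GRing.Theory.
Local Open Scope ring_scope.

(** Let [X] be the cone over [V] without the origin. By noetherianity, [V] is cut
    out by forms of one degree [E + 1] ([equations_of_one_degree]). Write [v_k(x)]
    for the [k]-th Veronese tensor of [x]; it has the coefficients
    [x_(i_1) ... x_(i_k)]. Let [U] be the span of the tensors [v_(E+1)(x)] for [x]
    in [X], let [b_j] be the contraction of the first index of a tensor with the
    [j]-th coordinate, so that [b_j(v_(E+1)(x)) = x_j v_E(x)], and let [W] be the sum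
    of the images [b_j(U)].

    The algebra is that of the lower triangular matrices of size three with scalars
    on the diagonal, and with [U], the formal combinations of the [b_j], and [W]
    below it. It is the path algebra of the quiver [0 => 1 => 2], with [dim U] arrows
    from [0] to [1] and one arrow from [1] to [2] for each [b_j], modulo an
    admissible ideal ([tri_ideal_admissible], [tri_presents]). The top is [S_0] and,
    if [V] is not empty, the dimension vector is [(1, dim U - 1, dim W - 1)]. The
    projective cover is [P = K + U + W], with radical [U + W]; as the quiver is
    acyclic and the top is simple, the Borel subgroup and the unipotent radical act
    on [P] by scalars, so every subspace of [P] is stable under them. The submodules
    in question are the planes [<u> + <w>] with [u] in [U] and [w] in [W] nonzero
    and every [b_j(u)] in [<w>] ([tri_moduli_max]).

    Elements of [U] are symmetric tensors, and the condition on [(u, w)] says that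
    the flattening of [u] along its first index has rank one. Hence, up to scalars,
    [u = v_(E+1)(x)] and [w = v_E(x)] for some [x] ([veronese_of_rank1]). Every form
    of degree [E + 1] that vanishes on [X] vanishes at [x], because it defines a
    linear functional that vanishes on [U]; so [x] is in [X] ([ver_moduliP]).

    The Pluecker coordinates of the plane of [x] are forms of degree [2E + 1] in
    [x]. Conversely, for each word [s] of length [E], the minors with row
    functionals [u |-> u_(j s)] and [w |-> w_s] are linear in the Pluecker
    coordinates and take the values [(x^s)^2 x_j], which recovers the point [x]
    where the monomial [x^s] does not vanish ([ver_iso]). *)

(** * Dickson's lemma and the degree of the equations of a projective set *)

Section Dickson.
Variable n : nat.
Implicit Types P : 'X_{1..n} -> Prop.

(** [P] contains finitely many monomials such that every monomial of [P] is a
    multiple of one of them. *)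
Definition finitely_dominated P : Prop :=
  exists s : seq 'X_{1..n}, (forall a, a \in s -> P a) /\
    forall b, P b -> exists2 a, a \in s & (a <= b)%MM.

Lemma finitely_dominated_union (I : finType) (P : I -> 'X_{1..n} -> Prop) :
  (forall i, finitely_dominated (P i)) ->
  finitely_dominated (fun b => exists i, P i b).
Proof.
move=> domP; suff [s [sP sdom]] : exists s : seq 'X_{1..n},
    (forall a, a \in s -> exists i, P i a) /\
    forall i b, i \in enum I -> P i b -> exists2 a, a \in s & (a <= b)%MM.
  by exists s; split=> // b [i]; apply: sdom; rewrite mem_enum.
elim: (enum I) => [|i e [s [sP sdom]]]; first by exists [::].
have [s' [s'P s'dom]] := domP i; exists (s' ++ s); split=> [a|j b].
  by rewrite mem_cat => /orP[/s'P|/sP //]; exists i.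
rewrite inE => /orP[/eqP-> /s'dom[a a_s le_ab]|/sdom dom_j /dom_j[a a_s le_ab]].
  by exists a; rewrite // mem_cat a_s.
by exists a; rewrite // mem_cat a_s orbT.
Qed.

(** By induction on the number of exponents that vary on [P]: given [a] in [P],
    a monomial of [P] that [a] does not divide has one of these exponents equal
    to one of finitely many values. *)
Lemma dickson_free (A : {set 'I_n}) P :
  (forall a b i, P a -> P b -> i \notin A -> a i = b i) -> finitely_dominated P.
Proof.
have [k] := ubnP #|A|; elim: k A P => // k IH A P ltAk agree.
have [[a Pa]|noP] := classic (exists a, P a); last first.
  by exists [::]; split=> // b Pb; case: noP; exists b.
pose slice (iv : 'I_n * 'I_(mdeg a)) b := [/\ P b, iv.1 \in A & b iv.1 = iv.2 :> nat].
have [|s [sP sdom]] := finitely_dominated_union (P := slice).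
  case=> i v; have [iA|niA] := boolP (i \in A); last first.
    by exists [::]; split=> // b [_ /=]; rewrite (negPf niA).
  apply: (IH (A :\ i)) => [|b c j [Pb _ bi] [Pc _ ci]].
    by move: ltAk; rewrite (cardsD1 i) iA.
  rewrite !inE negb_and negbK => /orP[/eqP->|]; first by rewrite bi ci.
  exact: agree.
exists (a :: s); split=> [c|b Pb].
  by rewrite inE => /orP[/eqP-> //|/sP[iv []]].
have [ab|nab] := boolP (a <= b)%MM; first by exists a; rewrite ?mem_head.
have /existsP[i lt_ba] : [exists i, b i < a i]%N.
  apply: contraNT nab => /existsPn le_ab; apply/mnm_lepP => i.
  by rewrite leqNgt le_ab.
have iA : i \in A by apply: contraLR lt_ba => niA; rewrite (agree a b i) // ltnn.
have lt_deg : (b i < mdeg a)%N.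
  by apply: leq_trans lt_ba _; rewrite mdegE (bigD1 i) //= leq_addr.
have [|c cs cb] := sdom b; first by exists (i, Ordinal lt_deg).
by exists c => //; rewrite inE cs orbT.
Qed.

Lemma dickson P : finitely_dominated P.
Proof. by apply: (@dickson_free setT) => a b i _ _; rewrite inE. Qed.

End Dickson.

Section Equations.
Variables (K : fieldType) (n : nat) (X : 'rV[K]_n -> Prop).
Implicit Types p q : {mpoly K[n]}.

(** The forms of any degree that vanish on [X]. *)
Definition vanishing_form p : Prop :=
  (exists D, p \is D.-homog) /\ forall x, X x -> meval_row p x = 0.

(** By reduction modulo forms whose leading monomials dominate all leading monomials
    of forms vanishing on [X]. *)
Lemma finite_equations :
  exists s : seq {mpoly K[n]}, (forall p, p \in s -> vanishing_form p) /\
    forall x, (forall p, p \in s -> meval_row p x = 0) ->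
      forall p, vanishing_form p -> meval_row p x = 0.
Proof.
pose lead_of m p := [/\ vanishing_form p, p != 0 & mlead p = m].
have [ms [msP msdom]] := dickson (fun m => exists p, lead_of m p).
have [s [sP s_ms]] : exists s : seq {mpoly K[n]}, (forall p, p \in s -> vanishing_form p) /\
    forall m, m \in ms -> exists2 p, p \in s & lead_of m p.
  elim: ms msP {msdom} => [|m ms IH] msP; first by exists [::].
  have [|s [sP s_ms]] := IH; first by move=> a a_ms; apply: msP; rewrite inE a_ms orbT.
  have [p p_m] := msP m (mem_head _ _).
  exists (p :: s); split=> [q|m'].
    by rewrite inE => /orP[/eqP->|/sP //]; case: p_m.
  rewrite inE => /orP[/eqP->|/s_ms[q qs q_m']]; first by exists p; rewrite ?mem_head.
  by exists q; rewrite // inE qs orbT.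
exists s; split=> // x sx; elim/mleadrect => p IH [[D homp] Xp].
have [->|p0] := eqVneq p 0; first by rewrite /meval_row meval0.
have [|_ /s_ms[q qs [[[Dq homq] Xq] q0 <-]] le_qp] := msdom (mlead p).
  by exists p; split=> //; split=> //; exists D.
set m := (mlead p - mlead q)%MM; pose c := mleadc p / mleadc q.
have defm : (m + mlead q = mlead p)%MM by exact: submK.
pose r := c *: 'X_[m] * q.
have r_x y : meval_row q y = 0 -> meval_row r y = 0.
  by rewrite /meval_row /r mevalM => ->; rewrite mulr0.
have c0 : c != 0 by rewrite mulf_neq0 ?invr_eq0 ?mleadc_eq0.
have cX0 : c *: 'X_[m] != 0 :> {mpoly K[n]}.
  by rewrite -mleadc_eq0 mleadZ // mleadXm mcoeffZ mcoeffX eqxx mulr1.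
have lead_r : mlead r = mlead p by rewrite /r mleadM // mleadZ // mleadXm defm.
have leadc_r : r@_(mlead p) = mleadc p.
  by rewrite -{1}defm -{1}[m](mleadXm K) -{1}(mleadZ 'X_[m] c0) /r mleadcM mleadZ //
     mleadXm mcoeffZ mcoeffX eqxx mulr1 divfK ?mleadc_eq0.
have homr : r \is D.-homog.
  have -> : D = (mdeg m + Dq)%N.
    have degp : mdeg (mlead p) = D := dhomog_mf homp (mlead_supp p0).
    have degq : mdeg (mlead q) = Dq := dhomog_mf homq (mlead_supp q0).
    by rewrite -degp -degq -mdegD defm.
  by rewrite dhomogM // dhomogZ // dhomogX.
have : meval_row (p - r) x = 0.
  have [->|pr0] := eqVneq (p - r) 0; first by rewrite /meval_row meval0.
  apply: IH; last first.
    split; first by exists D; rewrite rpredB.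
    by move=> y /[dup]/Xp py /Xq/r_x ry; rewrite /meval_row mevalB [_.@[_]]py [r.@[_]]ry subr0.
  have := mleadB_le p r; rewrite lead_r joinxx le_eqVlt => /predU1P[Epr|//].
  by move: pr0; rewrite -mleadc_eq0 Epr mcoeffB leadc_r subrr eqxx.
by rewrite /meval_row mevalB [r.@[_]]r_x ?subr0 // sx.
Qed.

(** Multiplying the equations by powers of the variables brings them to a common
    degree, without new common zeros other than the origin. *)
Lemma equations_of_one_degree :
  exists E, forall x, x != 0 ->
    (forall p, p \is E.+1.-homog -> (forall y, X y -> meval_row p y = 0) ->
       meval_row p x = 0) ->
    forall p, vanishing_form p -> meval_row p x = 0.
Proof.
have [s [sP s_eq]] := finite_equations.
have [E leE] : exists E, forall p, p \in s -> exists2 D, p \is D.-homog & (D <= E)%N.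
  elim: s sP {s_eq} => [|p s IH] sP; first by exists 0%N.
  have [|E leE] := IH; first by move=> q qs; apply: sP; rewrite inE qs orbT.
  have [[D homp] _] := sP p (mem_head _ _); exists (maxn D E) => q.
  rewrite inE => /orP[/eqP->|/leE[D' homq leD']]; first by exists D; rewrite ?leq_maxl.
  by exists D'; rewrite // leq_max leD' orbT.
exists E => x /rV0Pn[i xi0] hx; apply: s_eq => p ps.
have [D homp leDE] := leE p ps; have [_ Xp] := sP p ps.
have := hx ('X_i ^+ (E.+1 - D) * p).
rewrite /meval_row mevalM rmorphXn /= mevalXU => /(_ _ _)/eqP.
rewrite mulf_eq0 expf_eq0 (negPf xi0) andbF => h; apply/eqP/h => [|y Xy].
  suff : 'X_i ^+ (E.+1 - D) * p \is (1 * (E.+1 - D) + D).-homog.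
    by rewrite mul1n subnK // leqW.
  by apply: dhomogM homp; apply: dhomogMn; rewrite dhomogX /= mdeg1.
by rewrite mevalM [p.@[_]]Xp ?mulr0.
Qed.

End Equations.

(** * Veronese tensors *)

(** A set of vectors is spanned by finitely many of its elements. *)
Lemma finite_span (K : fieldType) (vT : vectType K) (P : vT -> Prop) :
  exists X : seq vT, (forall u, u \in X -> P u) /\ forall u, P u -> u \in <<X>>%VS.
Proof.
suff step k (X : seq vT) : (\dim {: vT} - \dim <<X>> < k)%N -> (forall u, u \in X -> P u) ->
    exists X : seq vT, (forall u, u \in X -> P u) /\ forall u, P u -> u \in <<X>>%VS.
  by apply: (step (\dim {: vT}).+1 [::]) => //; rewrite ltnS leq_subr.
elim: k X => // k IH X ltXk XP.
have [[u [Pu nuX]]|spanX] := classic (exists u, P u /\ u \notin <<X>>%VS).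
  apply: (IH (u :: X)) => [|v]; last by rewrite inE => /orP[/eqP->|/XP].
  have ltX : (\dim <<X>> < \dim <<u :: X>>)%N.
    rewrite ltnNge; apply: contra nuX => le_dim.
    have /eqP-> : <<X>>%VS == <<u :: X>>%VS.
      by rewrite eqEdim le_dim andbT sub_span // => v vX; rewrite inE vX orbT.
    by rewrite memv_span ?mem_head.
  apply: leq_trans (_ : (\dim {: vT} - \dim <<X>> <= k)%N) => //.
  by rewrite ltn_sub2l // (leq_trans ltX) // dimvS ?subvf.
exists X; split=> // u Pu; apply/negPn/negP => nuX.
by apply: spanX; exists u.
Qed.

Section Veronese.
Variables (K : fieldType) (n : nat).
Implicit Types (k : nat) (x : 'rV[K]_n).

(** Tensors of order [k]: a coefficient for each word of length [k] in the
    indices, whether the tensor is symmetric or not. *)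
Definition tensor k : Type := {ffun k.-tuple 'I_n -> K^o}.
HB.instance Definition _ k := Vector.on (tensor k).

(** The coefficients do not depend on the order of the indices. *)
Definition symmetric_tensor k (y : tensor k) : Prop :=
  forall s t : k.-tuple 'I_n, perm_eq s t -> y s = y t.

(** The tensor with the coefficient [x_(t_1) ... x_(t_k)] at the word [t]. *)
Definition veronese k x : tensor k := [ffun t : k.-tuple 'I_n => \prod_(i <- t) x 0 i].

Lemma veroneseE k x t : veronese k x t = \prod_(i <- t) x 0 i.
Proof. by rewrite ffunE. Qed.

Lemma veronese_symmetric k x : symmetric_tensor (veronese k x).
Proof. by move=> s t st; rewrite !veroneseE; apply: perm_big. Qed.

Lemma veroneseZ k c x : veronese k (c *: x) = c ^+ k *: veronese k x.
Proof.
apply/ffunP => t; rewrite [RHS]ffunE !veroneseE.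
under eq_bigr do rewrite mxE.
by rewrite big_split /= big_const_seq count_predT size_tuple -Monoid.iteropE.
Qed.

Lemma veronese_nseq k x i : veronese k x [tuple of nseq k i] = x 0 i ^+ k.
Proof. by rewrite veroneseE big_nseq -Monoid.iteropE. Qed.

Lemma veronese_neq0 k x : x != 0 -> veronese k x != 0.
Proof.
case/rV0Pn=> i xi0; apply/eqP => /(congr1 (fun y : tensor k => y [tuple of nseq k i])).
by rewrite veronese_nseq ffunE => /eqP; rewrite expf_eq0 (negPf xi0) andbF.
Qed.

Definition contract_fun k (j : 'I_n) (y : tensor k.+1) : tensor k :=
  [ffun t : k.-tuple 'I_n => y [tuple of j :: t]].

Lemma contract_linear k j : linear (@contract_fun k j).
Proof. by move=> c y z; apply/ffunP => t; rewrite !ffunE. Qed.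
HB.instance Definition _ k j :=
  GRing.isLinear.Build K (tensor k.+1) (tensor k) *:%R (@contract_fun k j)
    (@contract_linear k j).

(** Fixing the first index of a tensor. *)
Definition contract k (j : 'I_n) : 'Hom(tensor k.+1, tensor k) :=
  linfun (@contract_fun k j).

Lemma contractE k j (y : tensor k.+1) t : contract k j y t = y [tuple of j :: t].
Proof. by rewrite lfunE ffunE. Qed.

Lemma contract_veronese k j x :
  contract k j (veronese k.+1 x) = x 0 j *: veronese k x.
Proof.
by apply/ffunP => t; rewrite contractE [RHS]ffunE !veroneseE big_cons.
Qed.

Lemma contract_symmetric k j (y : tensor k.+1) :
  symmetric_tensor y -> symmetric_tensor (contract k j y).
Proof.
by move=> sy s t st; rewrite !contractE; apply: sy; rewrite /= perm_cons.
Qed.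

Lemma symmetricZ k c (y : tensor k) :
  symmetric_tensor y -> symmetric_tensor (c *: y).
Proof. by move=> sy s t st; rewrite !ffunE (sy s t). Qed.

Lemma symmetric_contractC k i j (y : tensor k.+2) :
  symmetric_tensor y -> contract k i (contract k.+1 j y) = contract k j (contract k.+1 i y).
Proof.
move=> sy; apply/ffunP => t; rewrite !contractE; apply: sy => /=.
exact: (permEl (perm_catCA [:: j] [:: i] t)).
Qed.

Lemma veroneseS k x j (t : k.-tuple 'I_n) :
  veronese k.+1 x [tuple of j :: t] = x 0 j * veronese k x t.
Proof. by rewrite !veroneseE big_cons. Qed.

(** A symmetric tensor whose flattening along the first index has rank one is
    a multiple of a Veronese tensor; [x] and [z] are the two factors. *)
Lemma veronese_of_rank1 k x (y : tensor k.+1) (z : tensor k) :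
  x != 0 -> symmetric_tensor y -> (forall j, contract k j y = x 0 j *: z) ->
  exists c, z = c *: veronese k x.
Proof.
case/rV0Pn=> i xi0; elim: k y z => [|k IH] y z sy rank1.
  exists (z [tuple]); apply/ffunP => t; rewrite tuple0 ffunE veroneseE big_nil.
  exact/esym/mulr1.
have sz : symmetric_tensor z.
  have -> : z = (x 0 i)^-1 *: contract k.+1 i y.
    by rewrite rank1 scalerA mulVf ?scale1r.
  exact/symmetricZ/contract_symmetric.
have rank1z j : contract k j z = x 0 j *: ((x 0 i)^-1 *: contract k i z).
  apply: (scalerI xi0); rewrite !scalerA mulrAC mulfV // mul1r.
  by have := symmetric_contractC j i sy; rewrite !rank1 !linearZ.
have [c Ec] := IH z _ sz rank1z; exists c; apply/ffunP => t.
have [j [t' ->]] : exists j (t' : k.-tuple 'I_n), t = [tuple of j :: t'].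
  by exists (thead t), [tuple of behead t]; rewrite -tuple_eta.
rewrite [RHS]ffunE veroneseS -contractE rank1z Ec scalerA [LHS]ffunE.
by rewrite -[RHS]/(_ * _) -[LHS]/(_ * _) mulrA [c * _]mulrC.
Qed.

(** A monomial of degree [k] is the product of the letters of a word of length
    [k]. *)
Lemma mnm_word k (m : 'X_{1..n}) : mdeg m = k ->
  exists t : k.-tuple 'I_n, forall x, \prod_(i <- t) x 0 i = \prod_i x 0 i ^+ m i.
Proof.
move=> degm; pose s := flatten [seq nseq (m i) i | i <- enum 'I_n].
have szs : size s == k.
  rewrite size_flatten /shape -map_comp sumnE big_map big_enum -degm mdegE.
  by apply/eqP/eq_bigr => i _; rewrite /= size_nseq.
exists (Tuple szs) => x; rewrite /= /s big_flatten big_map big_enum.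
by apply: eq_bigr => i _; rewrite big_nseq -Monoid.iteropE.
Qed.

(** The values of a form of degree [k] depend linearly on the Veronese tensor. *)
Lemma form_linear k (p : {mpoly K[n]}) : p \is k.-homog ->
  exists h : 'Hom(tensor k, K^o), forall x, meval_row p x = h (veronese k x).
Proof.
move=> homp; suff [h hE] : exists h : 'Hom(tensor k, K^o), forall x,
    \sum_(m <- msupp p) p@_m * \prod_i x 0 i ^+ m i = h (veronese k x).
  by exists h => x; rewrite /meval_row mevalE hE.
have : {in msupp p, forall m, mdeg m = k} := dhomog_mf homp.
elim: (msupp p) => [|m s IH] degs.
  by exists 0 => x; rewrite big_nil lfunE.
have [|h hE] := IH; first by move=> m' m's; apply: degs; rewrite inE m's orbT.
have [t tE] := mnm_word (degs m (mem_head _ _)).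
have evl : linear (fun y : tensor k => y t : K^o).
  by move=> c y z; rewrite !ffunE.
pose ev := linfun (HB.pack (fun y : tensor k => y t : K^o)
   (GRing.isLinear.Build _ _ _ _ _ evl) : {linear _ -> _}).
exists (p@_m *: ev + h) => x.
by rewrite big_cons hE -tE add_lfunE scale_lfunE [ev _]lfunE /= veroneseE.
Qed.

(** Conversely, linear functionals of the Veronese tensor are forms. *)
Lemma linear_form k (h : 'Hom(tensor k, K^o)) :
  exists2 p : {mpoly K[n]}, p \is k.-homog
    & forall x, meval_row p x = h (veronese k x).
Proof.
pose dt (t : k.-tuple 'I_n) : tensor k := [ffun s => (s == t)%:R].
have homX (s : seq 'I_n) : \prod_(i <- s) ('X_i : {mpoly K[n]}) \is (size s).-homog.
  elim: s => [|i s IH] /=; first by rewrite big_nil dhomog1.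
  by rewrite big_cons -add1n dhomogM // dhomogX /= mdeg1.
exists (\sum_t h (dt t) *: \prod_(i <- t) 'X_i) => [|x].
  apply: rpred_sum => t _; apply: rpredZ.
  by have := homX t; rewrite size_tuple.
have -> : veronese k x = \sum_t veronese k x t *: dt t.
  apply/ffunP => s; rewrite sum_ffunE (bigD1 s) //= big1 ?addr0 => [|t ts].
    by rewrite !ffunE eqxx; apply/esym/mulr1.
  by rewrite !ffunE eq_sym (negPf ts); apply: mulr0.
rewrite /meval_row !raddf_sum /=; apply: eq_bigr => t _.
rewrite mevalZ linearZ /= rmorph_prod /= veroneseE mulrC; congr (_ * _).
by apply: eq_bigr => i _; rewrite mevalXU.
Qed.

End Veronese.

(** * Representations of path algebras *)

Section PathLift.
Variables (K : fieldType) (Q : quiver) (L : algType K).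
Local Notation vertex := ('I_(qvert Q).+1).
Variables (e : vertex -> L) (arr : qarr Q -> L).

(** The product, from right to left, of the images of the arrows of a walk. *)
Fixpoint walk_val (i : vertex) (s : seq (qarr Q)) : L :=
  if s is a :: s' then walk_val (qtgt a) s' * arr a else e i.

(** The image of a path. *)
Definition path_val (p : qpath Q) : L := walk_val (qstart p) (qarrows p).

Hypothesis e_orth : forall i j, e i * e j = if i == j then e i else 0.
Hypothesis e_sum : \sum_i e i = 1.
Hypothesis arr_src : forall a, arr a * e (qsrc a) = arr a.

Lemma walk_val_src i s : qwalk i s -> walk_val i s * e i = walk_val i s.
Proof.
case: s => [|a s] /=; first by rewrite e_orth eqxx.
by case/andP=> /eqP <- _; rewrite -mulrA arr_src.
Qed.

Lemma walk_val_tgt i s : e (last i (map (@qtgt Q) s)) * walk_val i s = walk_val i s.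
Proof.
elim: s i => [|a s IH] i /=; first by rewrite e_orth eqxx.
by rewrite mulrA IH.
Qed.

Lemma walk_val_cat i s1 s2 : qwalk i (s1 ++ s2) ->
  walk_val i (s1 ++ s2) = walk_val (last i (map (@qtgt Q) s1)) s2 * walk_val i s1.
Proof.
elim: s1 i => [|a s1 IH] i /=; first by move=> /walk_val_src.
by case/andP=> _ ws; rewrite IH // mulrA.
Qed.

Lemma path_valM p q :
  path_val p * path_val q = oapp path_val 0 (qcomp p q).
Proof.
have qend_q : e (qend q) * path_val q = path_val q by exact: walk_val_tgt.
have qstart_p : path_val p * e (qstart p) = path_val p.
  by apply: walk_val_src; exact: (valP p).
have := qcompE p q; case: eqVneq => [pq|npq]; case: (qcomp p q) => //= u.
  case=> Eu; have := valP u; rewrite /= Eu => wu.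
  have -> : path_val u = walk_val (qstart q) (qarrows q ++ qarrows p).
    by rewrite /path_val /qstart /qarrows /= Eu.
  by rewrite walk_val_cat // -/(qend q) pq.
by rewrite -qstart_p -qend_q mulrA -[_ * _ * e _]mulrA e_orth eq_sym (negPf npq)
  mulr0 mul0r.
Qed.

(** The universal property of the path algebra. *)
Lemma path_lift : exists phi : {lrmorphism path_algebra K Q -> L},
  forall p, phi (qpath_elt K p) = path_val p.
Proof.
pose f (x : path_algebra K Q) : L :=
  \sum_(p <- monalg.msupp x) monalg.mcoeff p x *: path_val p.
have fw (d : {fset qpath Q}) (x : path_algebra K Q) : (monalg.msupp x `<=` d)%fset ->
    f x = \sum_(p <- d) monalg.mcoeff p x *: path_val p.
  move=> le_d; rewrite /f (big_fset_incl _ le_d) //= => p _ /monalg.mcoeff_outdom ->.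
  by rewrite scale0r.
have f_add : {morph f : x y / x + y}.
  move=> x y; set d := (monalg.msupp x `|` monalg.msupp y)%fset.
  rewrite (@fw d (x + y)) ?monalg.msuppD_le // (@fw d x) ?fsubsetUl // (@fw d y) ?fsubsetUr //.
  by rewrite -big_split; apply: eq_bigr => p _; rewrite /= monalg.mcoeffD scalerDl.
have f0 : f 0 = 0 by rewrite /f monalg.msupp0 big_seq_fset0.
have fT c o : f (qterm c o) = oapp (fun p => c *: path_val p) 0 o.
  case: o => [p|]; last by rewrite qtermN f0.
  rewrite (@fw [fset p]%fset) ?big_seq_fset1 ?qcoefT ?eqxx //.
  by rewrite qterm.unlock monalg.msuppU_le.
(* Only these three properties of [f] are used. *)
clearbody f.
have f_linear : linear f.
  move=> c x y; rewrite f_add; congr (_ + _).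
  elim/qalg_ind: x => [|x1 x2 IH1 IH2|b p]; first by rewrite scaler0 f0 scaler0.
    by rewrite (scalerDr c x1) (f_add (c *: x1)) (f_add x1) [RHS]scalerDr; congr (_ + _).
  by rewrite -qtermZ !fT /= scalerA.
have f_monoid : monoid_morphism f.
  split.
    rewrite -e_sum -[1]/(qone K Q) /qone (big_morph f f_add f0).
    by apply: eq_bigr => i _; rewrite /qpath_elt fT /= scale1r.
  move=> x y; elim/qalg_ind: x => [|x1 x2 IH1 IH2|c p]; first by rewrite mul0r f0 mul0r.
    by rewrite (mulrDl x1) (f_add (x1 * y)) (f_add x1) [RHS]mulrDl; congr (_ + _).
  elim/qalg_ind: y => [|y1 y2 IH1 IH2|d q]; first by rewrite mulr0 f0 mulr0.
    by rewrite (mulrDr _ y1) (f_add (_ * y1)) (f_add y1) [RHS]mulrDr; congr (_ + _).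
  rewrite -[_ * _ in LHS]/(qmul _ _) qmulUU !fT /= -scalerAl -scalerAr path_valM.
  by case: (qcomp p q) => [u|] /=; rewrite ?scaler0 ?scalerA.
pose fR : {lrmorphism path_algebra K Q -> L} := HB.pack f
  (GRing.isLinear.Build _ _ _ _ _ f_linear)
  (GRing.isMonoidMorphism.Build _ _ _ f_monoid).
by exists fR => p; rewrite -[fR _]/(f _) fT /= scale1r.
Qed.

End PathLift.

(** * The triangular algebra of a family of linear maps *)

Local Notation v0 := (@Ordinal 3 0 isT).
Local Notation v1 := (@Ordinal 3 1 isT).
Local Notation v2 := (@Ordinal 3 2 isT).

Lemma ord3P (P : 'I_3 -> Prop) : P v0 -> P v1 -> P v2 -> forall i, P i.
Proof.
move=> P0 P1 P2 [[|[|[|//]]] lti]; [move: P0|move: P1|move: P2];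
  by congr (P _); apply: val_inj.
Qed.

(** Three diagonal scalars, an element of [U], the coefficients of a formal linear
    combination of the maps [b j], and an element of [W], seen as the lower
    triangular matrix
[[
    a0  .   .
    u   a1  .
    w   c   a2
]]
    where the product of [c] and [u] is the sum of the [c_j b_j(u)]. The family [b]
    is a parameter of the type because the product depends on it. *)
Definition tri (K : fieldType) (U W : vectType K) (n : nat)
  of 'I_n -> 'Hom(U, W) : Type := ('rV[K]_3 * U * 'rV[K]_n * W)%type.
HB.instance Definition _ (K : fieldType) (U W : vectType K) (n : nat)
  (b : 'I_n -> 'Hom(U, W)) := Vector.on (tri b).

Section Tri.
Variables (K : fieldType) (U W : vectType K) (n : nat) (b : 'I_n -> 'Hom(U, W)).
Local Notation tri := (tri b).

Definition tri_diag (x : tri) : 'rV[K]_3 := x.1.1.1.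
Definition tri_u (x : tri) : U := x.1.1.2.
Definition tri_b (x : tri) : 'rV[K]_n := x.1.2.
Definition tri_w (x : tri) : W := x.2.

Lemma triP (x y : tri) :
  tri_diag x = tri_diag y -> tri_u x = tri_u y -> tri_b x = tri_b y -> tri_w x = tri_w y ->
  x = y.
Proof.
by case: x => -[[a u] c] w; case: y => -[[a' u'] c'] w'; rewrite /tri_diag /tri_u
  /tri_b /tri_w /= => -> -> -> ->.
Qed.

Lemma tri_diag_linear : linear tri_diag. Proof. by []. Qed.
Lemma tri_u_linear : linear tri_u. Proof. by []. Qed.
Lemma tri_b_linear : linear tri_b. Proof. by []. Qed.
Lemma tri_w_linear : linear tri_w. Proof. by []. Qed.
HB.instance Definition _ := GRing.isLinear.Build K tri 'rV[K]_3 *:%R tri_diag tri_diag_linear.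
HB.instance Definition _ := GRing.isLinear.Build K tri U *:%R tri_u tri_u_linear.
HB.instance Definition _ := GRing.isLinear.Build K tri 'rV[K]_n *:%R tri_b tri_b_linear.
HB.instance Definition _ := GRing.isLinear.Build K tri W *:%R tri_w tri_w_linear.

(** The value at [u] of the linear combination of the maps [b j] with the
    coefficients [c]. *)
Definition bact (c : 'rV[K]_n) (u : U) : W := \sum_j c 0 j *: b j u.

Lemma bactDl c d u : bact (c + d) u = bact c u + bact d u.
Proof. by rewrite /bact -big_split; apply: eq_bigr => j _; rewrite !mxE scalerDl. Qed.
Lemma bactDr c u v : bact c (u + v) = bact c u + bact c v.
Proof. by rewrite /bact -big_split; apply: eq_bigr => j _; rewrite linearD scalerDr. Qed.
Lemma bactZl a c u : bact (a *: c) u = a *: bact c u.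
Proof. by rewrite /bact scaler_sumr; apply: eq_bigr => j _; rewrite mxE scalerA. Qed.
Lemma bactZr a c u : bact c (a *: u) = a *: bact c u.
Proof.
by rewrite /bact scaler_sumr; apply: eq_bigr => j _; rewrite linearZ !scalerA mulrC.
Qed.

(** The product of lower triangular matrices. *)
Definition tri_mul (x y : tri) : tri :=
  ((\row_i (tri_diag x 0 i * tri_diag y 0 i),
    tri_diag y 0 v0 *: tri_u x + tri_diag x 0 v1 *: tri_u y,
    tri_diag y 0 v1 *: tri_b x + tri_diag x 0 v2 *: tri_b y),
    tri_diag y 0 v0 *: tri_w x + tri_diag x 0 v2 *: tri_w y + bact (tri_b x) (tri_u y)).

Definition tri_one : tri := (const_mx 1, 0, 0, 0).

Lemma tri_mulA : associative tri_mul.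
Proof.
move=> x y z; apply: triP.
- by apply/rowP => i; rewrite !mxE mulrA.
- rewrite /tri_mul /tri_u /tri_diag /= !mxE !scalerDr !scalerA -addrA.
  by congr (_ + (_ + _)); rewrite mulrC.
- rewrite /tri_mul /tri_b /tri_diag /= !mxE !scalerDr !scalerA -addrA.
  by congr (_ + (_ + _)); rewrite mulrC.
rewrite /tri_mul /tri_w /tri_u /tri_b /tri_diag /= !mxE !scalerDr !scalerA.
rewrite bactDl bactDr !bactZl !bactZr -!addrA.
congr (_ + _); first by rewrite mulrC.
congr (_ + _); first by rewrite mulrC.
by rewrite [RHS]addrCA; congr (_ + _); rewrite [RHS]addrA [RHS]addrC.
Qed.

Lemma bact0l u : bact 0 u = 0.
Proof. by rewrite -(scale0r 0) bactZl scale0r. Qed.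
Lemma bact0r c : bact c 0 = 0.
Proof. by rewrite -(scale0r 0) bactZr scale0r. Qed.

Lemma tri_mul1l : left_id tri_one tri_mul.
Proof.
move=> x; apply: triP; rewrite /tri_mul /tri_one /tri_diag /tri_u /tri_b /tri_w /=.
- by apply/rowP => i; rewrite !mxE mul1r.
- by rewrite !mxE scaler0 add0r scale1r.
- by rewrite !mxE scaler0 add0r scale1r.
- by rewrite !mxE scaler0 add0r scale1r bact0l addr0.
Qed.

Lemma tri_mul1r : right_id tri_one tri_mul.
Proof.
move=> x; apply: triP; rewrite /tri_mul /tri_one /tri_diag /tri_u /tri_b /tri_w /=.
- by apply/rowP => i; rewrite !mxE mulr1.
- by rewrite !mxE scaler0 addr0 scale1r.
- by rewrite !mxE scaler0 addr0 scale1r.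
- by rewrite !mxE scaler0 addr0 scale1r bact0r addr0.
Qed.

Lemma tri_mulDl : left_distributive tri_mul +%R.
Proof.
move=> x y z; apply: triP; rewrite /tri_mul /tri_diag /tri_u /tri_b /tri_w /=.
- by apply/rowP => i; rewrite !mxE mulrDl.
- by rewrite !mxE scalerDr scalerDl addrACA.
- by rewrite !mxE scalerDr scalerDl addrACA.
- by rewrite !mxE bactDl !(scalerDr, scalerDl) [RHS]addrACA; congr (_ + _); rewrite addrACA.
Qed.

Lemma tri_mulDr : right_distributive tri_mul +%R.
Proof.
move=> x y z; apply: triP; rewrite /tri_mul /tri_diag /tri_u /tri_b /tri_w /=.
- by apply/rowP => i; rewrite !mxE mulrDr.
- by rewrite !mxE scalerDr scalerDl addrACA.
- by rewrite !mxE scalerDr scalerDl addrACA.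
- by rewrite !mxE bactDr !(scalerDr, scalerDl) [RHS]addrACA; congr (_ + _); rewrite addrACA.
Qed.

Lemma tri_one_neq0 : tri_one != 0.
Proof.
apply/eqP => /(congr1 (fun x => tri_diag x 0 v0)); rewrite /tri_diag /= !mxE.
by move/eqP; rewrite oner_eq0.
Qed.

HB.instance Definition _ := GRing.Zmodule_isNzRing.Build tri
  tri_mulA tri_mul1l tri_mul1r tri_mulDl tri_mulDr tri_one_neq0.

Lemma tri_scaleAl (c : K) (x y : tri) : c *: (x * y) = (c *: x) * y.
Proof.
apply: triP; rewrite /GRing.mul /= /tri_mul /tri_diag /tri_u /tri_b /tri_w /=.
- by apply/rowP => i; rewrite !mxE mulrA.
- by rewrite !mxE !scalerDr !scalerA mulrC.
- by rewrite !mxE !scalerDr !scalerA mulrC.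
- by rewrite !mxE !scalerDr !scalerA bactZl [c * _]mulrC.
Qed.

Lemma tri_scaleAr (c : K) (x y : tri) : c *: (x * y) = x * (c *: y).
Proof.
apply: triP; rewrite /GRing.mul /= /tri_mul /tri_diag /tri_u /tri_b /tri_w /=.
- by apply/rowP => i; rewrite !mxE mulrCA.
- by rewrite !mxE !scalerDr !scalerA [_ * c]mulrC.
- by rewrite !mxE !scalerDr !scalerA [_ * c]mulrC.
- by rewrite !mxE !scalerDr !scalerA bactZr [_ * c]mulrC.
Qed.

HB.instance Definition _ := GRing.Lmodule_isLalgebra.Build K tri tri_scaleAl.
HB.instance Definition _ := GRing.Lalgebra_isAlgebra.Build K tri tri_scaleAr.
HB.instance Definition _ := Algebra_isFalgebra.Build K tri.

End Tri.

(** The quiver [0 => 1 => 2] with [k] arrows from [0] to [1] and [n] arrows from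
    [1] to [2]. *)
Definition tri_quiver (k n : nat) : quiver :=
  @Quiver 2 ('I_k + 'I_n)%type (fun a => if a is inl _ then v0 else v1)
    (fun a => if a is inl _ then v1 else v2).

Section Presentation.
Variables (K : fieldType) (U W : vectType K) (n : nat) (b : 'I_n -> 'Hom(U, W)).
Local Notation tri := (tri b).
Local Notation Q := (tri_quiver (\dim {: U}) n).

(** Matrices given by their diagonal and their three other entries. *)
Definition Tri (a : 'rV[K]_3) (u : U) (c : 'rV[K]_n) (w : W) : tri := (a, u, c, w).

Lemma tri_diagM (x y : tri) i : tri_diag (x * y) 0 i = tri_diag x 0 i * tri_diag y 0 i.
Proof. by rewrite [LHS]mxE. Qed.
Lemma tri_uM (x y : tri) :
  tri_u (x * y) = tri_diag y 0 v0 *: tri_u x + tri_diag x 0 v1 *: tri_u y.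
Proof. by []. Qed.
Lemma tri_bM (x y : tri) :
  tri_b (x * y) = tri_diag y 0 v1 *: tri_b x + tri_diag x 0 v2 *: tri_b y.
Proof. by []. Qed.
Lemma tri_wM (x y : tri) :
  tri_w (x * y) = tri_diag y 0 v0 *: tri_w x + tri_diag x 0 v2 *: tri_w y
                  + bact b (tri_b x) (tri_u y).
Proof. by []. Qed.

Lemma TriM a u c w a' u' c' w' :
  Tri a u c w * Tri a' u' c' w' =
  Tri (\row_i (a 0 i * a' 0 i)) (a' 0 v0 *: u + a 0 v1 *: u')
      (a' 0 v1 *: c + a 0 v2 *: c') (a' 0 v0 *: w + a 0 v2 *: w' + bact b c u').
Proof. by []. Qed.

(** The diagonal idempotents. *)
Definition tri_e (i : 'I_3) : tri := Tri (delta_mx 0 i) 0 0 0.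

(** The images of the arrows: the vectors of a basis of [U], and the maps [b j]
    as formal symbols. *)
Definition tri_arr (a : qarr Q) : tri :=
  match a with
  | inl k => Tri 0 (vbasis {: U})`_k 0 0
  | inr j => Tri 0 0 (delta_mx 0 j) 0
  end.

Lemma tri_e_orth i j : tri_e i * tri_e j = if i == j then tri_e i else 0.
Proof.
rewrite TriM !scaler0 bact0l !addr0.
pose d : 'rV[K]_3 := if i == j then delta_mx 0 i else 0.
have -> : \row_k ((delta_mx 0 i : 'rV[K]_3) 0 k * (delta_mx 0 j : 'rV[K]_3) 0 k) = d.
  rewrite /d; apply/rowP => k; rewrite !mxE !eqxx /=; case: (eqVneq i j) => [->|nij];
    rewrite mxE ?eqxx.
    by rewrite -natrM mulnb andbb.
  by case: (eqVneq k i) => [->|_]; rewrite ?mul0r // (negPf nij) mulr0.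
by rewrite /d; case: eqP.
Qed.

Lemma tri_e_sum : \sum_i tri_e i = 1.
Proof.
apply: triP; rewrite raddf_sum /=; try by rewrite big1.
apply/rowP => k; rewrite summxE (bigD1 k) //= !mxE !eqxx big1 ?addr0 //.
by move=> i ik; rewrite mxE eq_sym (negPf ik) andbF.
Qed.

Lemma tri_arr_src a : tri_arr a * tri_e (@qsrc Q a) = tri_arr a.
Proof.
case: a => j; rewrite /= TriM !mxE !eqxx ?scale0r ?scaler0 ?scale1r ?bact0r ?addr0 ?add0r;
  by congr Tri; apply/rowP => i; rewrite !mxE mul0r.
Qed.

Lemma tri_arr_tgt a : tri_e (@qtgt Q a) * tri_arr a = tri_arr a.
Proof.
case: a => j; rewrite /= TriM !mxE !eqxx ?scale0r ?scaler0 ?scale1r ?bact0l ?addr0 ?add0r;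
  by congr Tri; apply/rowP => i; rewrite !mxE mulr0.
Qed.

Lemma tri_diag_arr a i : tri_diag (tri_arr a) 0 i = 0.
Proof. by case: a => j; rewrite mxE. Qed.

Lemma tri_walk_len i s : @qwalk Q i s -> (size s <= 2)%N.
Proof.
case: s => [|a [|a' [|a'' s]]] //=.
by case: a => j; case: a' => j'; case: a'' => j''; rewrite //= ?andbF.
Qed.

(** An arrow as a path of length one. *)
Definition arr_path (a : qarr Q) : qpath Q :=
  exist _ (@qsrc Q a, [:: a]) (introT andP (conj (eqxx _) isT)).

Lemma short_path (p : qpath Q) : (qlen p < 2)%N ->
  (exists i, p = qtriv i) \/ exists a, p = arr_path a.
Proof.
case: p => -[i [|a [|//]]] wp _; [left; exists i | right; exists a]; apply: val_inj => //=.
by move: (wp) => /= /andP[/eqP->].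
Qed.

Local Notation tri_val := (@path_val K Q tri tri_e tri_arr).

(* The next three lemmas compute the entries of the image of a path. They show
   that the coefficients of an element of the path algebra at the paths of length
   at most one can be read off its image. *)
Lemma tri_val_diag (p : qpath Q) i : tri_diag (tri_val p) 0 i = (p == @qtriv Q i)%:R.
Proof.
rewrite -val_eqE /=; case: p => -[j [|a s]] wp; rewrite /path_val /=.
  by rewrite mxE eqxx /= eq_sym xpair_eqE andbT.
by rewrite tri_diagM tri_diag_arr mulr0 xpair_eqE andbF.
Qed.

Lemma tri_val_u (p : qpath Q) k :
  coord (vbasis {: U}) k (tri_u (tri_val p)) = (p == arr_path (inl k))%:R.
Proof.
rewrite -val_eqE /=; case: p => -[j [|a [|a' s]]] wp; rewrite /path_val /=.
- by rewrite linear0 xpair_eqE andbF.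
- rewrite tri_uM tri_diag_arr scale0r add0r xpair_eqE eqseq_cons andbT.
  move: wp => /=; rewrite andbT => /eqP <-.
  case: a => k'; last by rewrite /= scaler0 linear0.
  by rewrite /= mxE !eqxx scale1r coord_free ?(basis_free (vbasisP _)) // eq_sym.
- by rewrite !tri_uM !tri_diagM !tri_diag_arr !mulr0 !scale0r !add0r linear0
    xpair_eqE eqseq_cons !andbF.
Qed.

Lemma tri_val_b (p : qpath Q) k :
  tri_b (tri_val p) 0 k = (p == arr_path (inr k))%:R.
Proof.
rewrite -val_eqE /=; case: p => -[j [|a [|a' s]]] wp; rewrite /path_val /=.
- by rewrite mxE xpair_eqE andbF.
- rewrite tri_bM tri_diag_arr scale0r add0r xpair_eqE eqseq_cons andbT.
  move: wp => /=; rewrite andbT => /eqP <-.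
  case: a => k'; first by rewrite /= scaler0 mxE.
  by rewrite /= !mxE !eqxx mul1r eq_sym.
- by rewrite !tri_bM !tri_diagM !tri_diag_arr !mulr0 !scale0r !add0r mxE
    xpair_eqE eqseq_cons !andbF.
Qed.

Variable phi : {lrmorphism path_algebra K Q -> tri}.
Hypothesis phiE : forall p, phi (qpath_elt K p) = tri_val p.

(** A functional that is dual to the path [q] on the images of the paths computes
    the coefficient at [q]. *)
Lemma phi_coef (h : tri -> K) (q : qpath Q) :
  {morph h : x y / x + y} -> (forall c x, h (c *: x) = c * h x) ->
  (forall p, h (tri_val p) = (p == q)%:R) ->
  forall x, h (phi x) = monalg.mcoeff q x.
Proof.
move=> hD hZ hE; have h0 : h 0 = 0 by rewrite -(scale0r 0) hZ mul0r.
elim/qalg_ind => [|x y IHx IHy|c p].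
- by rewrite linear0 h0 monalg.mcoeff0.
- by rewrite (linearD phi) hD IHx IHy monalg.mcoeffD.
have -> : qterm c (Some p) = c *: qpath_elt K p by rewrite -qtermZ mulr1.
by rewrite linearZ /= hZ phiE hE qcoefZ qcoefT.
Qed.

(** The relations of the triangular algebra: the kernel of [phi]. *)
Definition tri_ideal (x : path_algebra K Q) : Prop := phi x = 0.

(** A relation has no path of length less than two by [phi_coef], and the quiver
    has no path of length three. *)
Lemma tri_ideal_admissible : admissible_ideal tri_ideal.
Proof.
split.
- split; rewrite /tri_ideal; first exact: linear0.
    by move=> x y x0 y0; rewrite linearD /= x0 y0 addr0.
  by move=> a x c x0; rewrite !rmorphM /= x0 mulr0 mul0r.
- move=> x x0 p px; rewrite leqNgt; apply/negP => /short_path short.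
  suff : monalg.mcoeff p x = 0 by apply/eqP; rewrite monalg.mcoeff_neq0.
  case: short => [[i ->]|[[k|j] ->]].
  + rewrite -(@phi_coef (fun y => tri_diag y 0 i)) ?x0 ?mxE //.
    * by move=> y z; rewrite linearD mxE.
    * by move=> c y; rewrite linearZ mxE.
    * by move=> q; apply: tri_val_diag.
  + rewrite -(@phi_coef (fun y => coord (vbasis {: U}) k (tri_u y))) ?x0 ?linear0 //.
    * by move=> y z; rewrite !linearD.
    * by move=> c y; rewrite !linearZ.
    * by move=> q; apply: tri_val_u.
  + rewrite -(@phi_coef (fun y => tri_b y 0 j)) ?x0 ?mxE //.
    * by move=> y z; rewrite linearD mxE.
    * by move=> c y; rewrite linearZ mxE.
    * by move=> q; apply: tri_val_b.
exists 3 => x long; have -> : x = 0; last exact: linear0.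
apply/monalg.malgP => p; rewrite monalg.mcoeff0.
have [/long|/monalg.mcoeff_outdom //] := boolP (p \in monalg.msupp x).
by rewrite leqNgt ltnS (tri_walk_len (valP p)).
Qed.

Hypothesis b_full : (\sum_j limg (b j) = fullv)%VS.

(** The part [W] is reached through the products of arrows, which is where the
    hypothesis [b_full] is needed. *)
Lemma tri_presents : presents tri_ideal phi.
Proof.
split=> // a.
pose Im y := exists x, phi x = y.
have ImD y z : Im y -> Im z -> Im (y + z).
  by case=> x <- [x' <-]; exists (x + x'); rewrite linearD.
have ImZ c y : Im y -> Im (c *: y) by case=> x <-; exists (c *: x); rewrite linearZ.
have ImM y z : Im y -> Im z -> Im (y * z).
  by case=> x <- [x' <-]; exists (x * x'); rewrite rmorphM.
have Im0 : Im 0 by exists 0; rewrite linear0.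
have Ime i : Im (tri_e i) by exists (qpath_elt K (@qtriv Q i)); rewrite phiE.
have Ima c : Im (tri_arr c).
  exists (qpath_elt K (arr_path c)); rewrite phiE /path_val /=.
  exact: tri_arr_tgt.
have Imu u : Im (Tri 0 u 0 0).
  have -> : Tri 0 u 0 0 = \sum_k coord (vbasis {: U}) k u *: tri_arr (inl k).
    apply: triP; rewrite raddf_sum /=; under eq_bigr do rewrite ?linearZ;
      rewrite /tri_diag /tri_u /tri_b /tri_w /=; try by rewrite big1 // => k _; rewrite scaler0.
    exact: coord_vbasis (memvf u).
  by apply: (big_ind Im) => // k _; apply: ImZ.
have Imb c : Im (Tri 0 0 c 0).
  have -> : Tri 0 0 c 0 = \sum_j c 0 j *: tri_arr (inr j).
    apply: triP; rewrite raddf_sum /=; under eq_bigr do rewrite ?linearZ;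
      rewrite /tri_diag /tri_u /tri_b /tri_w /=; try by rewrite big1 // => k _; rewrite scaler0.
    exact: row_sum_delta.
  by apply: (big_ind Im) => // k _; apply: ImZ.
have Imw w : Im (Tri 0 0 0 w).
  have : w \in (\sum_j limg (b j))%VS by rewrite b_full memvf.
  case/memv_sumP => v vP ->.
  have -> : Tri 0 0 0 (\sum_j v j) = \sum_j Tri 0 0 0 (v j).
    by apply: triP; rewrite raddf_sum /= /tri_diag /tri_u /tri_b /tri_w //= big1.
  apply: (big_ind Im) => // j _; have /memv_imgP[u _ ->] := vP j isT.
  have -> : Tri 0 0 0 (b j u) = Tri 0 0 (delta_mx 0 j) 0 * Tri 0 u 0 0.
    rewrite TriM !mxE !scale0r !add0r; congr Tri.
      by apply/rowP => k; rewrite !mxE mul0r.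
    rewrite /bact (bigD1 j) //= mxE !eqxx scale1r big1 ?addr0 //.
    by move=> k kj; rewrite mxE (negPf kj) andbF scale0r.
  by apply: ImM.
have Imd d : Im (Tri d 0 0 0).
  have -> : Tri d 0 0 0 = \sum_i d 0 i *: tri_e i.
    apply: triP; rewrite raddf_sum /=; under eq_bigr do rewrite ?linearZ;
      rewrite /tri_diag /tri_u /tri_b /tri_w /=; try by rewrite big1 // => k _; rewrite scaler0.
    exact: row_sum_delta.
  by apply: (big_ind Im) => // k _; apply: ImZ.
case: a => -[[d u] c] w.
rewrite -[(_, w)]/(Tri d u c w) -/(Im _).
have -> : Tri d u c w = Tri d 0 0 0 + Tri 0 u 0 0 + Tri 0 0 c 0 + Tri 0 0 0 w.
  by apply: triP; rewrite ![in RHS]linearD /= ?addr0 ?add0r.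
exact: ImD _ _ (ImD _ _ (ImD _ _ (Imd d) (Imu u)) (Imb c)) (Imw w).
Qed.

End Presentation.

(** * Submodules of the projective cover of the simple module at the source *)

Section TriModuli.
Variables (K : fieldType) (U W : vectType K) (n : nat) (b : 'I_n -> 'Hom(U, W)).
Local Notation tri := (tri b).
Local Notation e := (tri_e b).

(** The matrices with zero as their first diagonal entry form a maximal left
    ideal. *)
Lemma tri_diag_jacobson (a : tri) : jacobson_radical a -> tri_diag a 0 v0 = 0.
Proof.
have hl : linear (fun a : tri => tri_diag a 0 v0 : K^o).
  by move=> c x y; rewrite linearP !mxE.
pose h : {linear tri -> K^o} := HB.pack (fun a : tri => tri_diag a 0 v0 : K^o)
   (GRing.isLinear.Build _ _ _ _ _ hl).
have hE y : (y \in lker (linfun h)) = (tri_diag y 0 v0 == 0).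
  by rewrite memv_ker lfunE.
move=> /(_ (lker (linfun h))); rewrite hE => ja; apply/eqP/ja; split.
- by move=> x y; rewrite !hE tri_diagM => /eqP->; rewrite mulr0.
- move=> full; have : 1 \in lker (linfun h) by rewrite full memvf.
  by rewrite hE mxE oner_eq0.
move=> N idN MN; have [NM|] := boolP (N <= lker (linfun h))%VS.
  by left; apply/eqP; rewrite eqEsubv NM.
case/subvPn=> y yN; rewrite hE => y0; right.
apply/eqP; rewrite eqEsubv subvf; apply/subvP => x _.
pose c := tri_diag x 0 v0 / tri_diag y 0 v0.
rewrite -(subrK (c *: y) x) rpredD ?rpredZ //; apply: subvP MN _ _.
have E : tri_diag (x - c *: y) = tri_diag x - c *: tri_diag y by [].
by rewrite hE E !mxE divfK ?subrr.
Qed.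

Lemma tri_nilpotent (a : tri) : tri_diag a = 0 -> a * a * a = 0.
Proof.
move=> a0; apply: triP.
- by apply/rowP => i; rewrite !tri_diagM a0 !mxE mulr0.
- by rewrite tri_uM tri_diagM a0 !mxE mul0r !scale0r addr0.
- by rewrite tri_bM tri_diagM a0 !mxE mul0r !scale0r addr0.
by rewrite tri_wM tri_diagM tri_bM a0 !mxE mul0r !scale0r !addr0 add0r bact0l.
Qed.

(** A nilpotent left ideal lies in every maximal left ideal [M]: otherwise
    [1 = m + y] with [m] in [M] and [y] nilpotent, and [m = 1 - y] has the left
    inverse [1 + y + y^2]. *)
Lemma tri_jacobson (a : tri) : tri_diag a = 0 -> jacobson_radical a.
Proof.
move=> a0 M [idM nfull maxM]; apply/negPn/negP => naM.
pose N := lker (linfun (@tri_diag K U W n b)).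
have NE y : (y \in N) = (tri_diag y == 0) by rewrite memv_ker lfunE.
have aN : a \in N by rewrite NE a0.
have [] := maxM (M + N)%VS.
- move=> x _ /memv_addP[m mM [y yN ->]]; rewrite mulrDr memv_add ?idM //.
  rewrite NE; apply/eqP/rowP => i; rewrite tri_diagM.
  by move: yN; rewrite NE => /eqP ->; rewrite !mxE mulr0.
- exact: addvSl.
- move=> E; case/negP: naM; rewrite -E; apply: subvP aN; exact: addvSr.
move=> full; apply: nfull; apply/eqP; rewrite eqEsubv subvf /=; apply/subvP => x _.
have : 1 \in (M + N)%VS by rewrite full memvf.
case/memv_addP=> m mM [y yN E1]; rewrite -[x]mulr1.
suff -> : 1 = (1 + y + y * y) * m by rewrite mulrA idM.
have -> : m = 1 - y by rewrite E1 addrK.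
move: yN; rewrite NE => /eqP/tri_nilpotent y3.
rewrite mulrBr mulr1 !mulrDl mul1r y3 addr0.
by rewrite -[1 + y + _]addrA addrK.
Qed.

(** The top is the simple module at the source [0]. *)
Definition tri_top (i : 'I_3) : nat := i == v0.
Local Notation t := tri_top.
Local Notation P := (projT e t).

(** The only index of a generator of the projective cover. *)
Definition z_idx : zidx t := Tagged (fun i => 'I_(t i)) (Ordinal (isT : 0 < t v0)%N).
(** The generator of the projective cover. *)
Definition z0 : P := zgen e (Ordinal (isT : 0 < t v0)%N).

Lemma zidxE (r : zidx t) : r = z_idx.
Proof.
case: r => i k; have [Ei|ni] := eqVneq i v0; last first.
  by exfalso; case: k => m; rewrite /t (negPf ni).
subst i; congr Tagged; apply: val_inj; case: k => m /=.
by rewrite /t eqxx ltnS leqn0 => /eqP.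
Qed.

(** The component of an element of the projective module, which is its only one. *)
Definition component (x : P) : tri := vsval x z_idx.

Lemma component_linear : linear component.
Proof. by move=> c x y; rewrite /component linearP !ffunE. Qed.
HB.instance Definition _ := GRing.isLinear.Build K P tri *:%R component component_linear.

Lemma component_inj : injective component.
Proof. by move=> x y xy; apply: val_inj; apply/ffunP => r; rewrite (zidxE r). Qed.

Lemma component_lact a x : component (lact a x) = a * component x.
Proof. exact: lactE. Qed.

Lemma component_z0 : component z0 = e v0.
Proof. by rewrite /component zgenE eqxx. Qed.

Lemma tri_diag_e i j : tri_diag (e i) 0 j = (j == i)%:R.
Proof. by rewrite mxE. Qed.

(** The coordinates [K], [U], [W] of the projective module. *)
Definition prK (x : P) : K^o := tri_diag (component x) 0 v0.
Definition prU (x : P) : U := tri_u (component x).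
Definition prW (x : P) : W := tri_w (component x).

Lemma prK_linear : linear prK.
Proof. by move=> c x y; rewrite /prK !linearP !mxE. Qed.
Lemma prU_linear : linear prU.
Proof. by move=> c x y; rewrite /prU !linearP. Qed.
Lemma prW_linear : linear prW.
Proof. by move=> c x y; rewrite /prW !linearP. Qed.
HB.instance Definition _ := GRing.isLinear.Build K P K^o *:%R prK prK_linear.
HB.instance Definition _ := GRing.isLinear.Build K P U *:%R prU prU_linear.
HB.instance Definition _ := GRing.isLinear.Build K P W *:%R prW prW_linear.

Lemma component_source x : exists a, component x = a * e v0.
Proof. by have /mem_projT_space/(_ z_idx) := subvsP x. Qed.

Lemma pr_inj x y : prK x = prK y -> prU x = prU y -> prW x = prW y -> x = y.
Proof.
rewrite /prK /prU /prW => xyK xyU xyW; apply: component_inj; apply: triP => //.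
  have [a Ea] := component_source x; have [a' Ea'] := component_source y.
  move: xyK; rewrite Ea Ea' => xyK; apply/rowP; apply: ord3P => //.
    by rewrite !tri_diagM !tri_diag_e !mulr0.
  by rewrite !tri_diagM !tri_diag_e !mulr0.
have [a ->] := component_source x; have [a' ->] := component_source y.
by rewrite !tri_bM !tri_diag_e !scale0r !scaler0.
Qed.

Lemma prK_lact a x : prK (lact a x) = tri_diag a 0 v0 * prK x.
Proof. by rewrite /prK component_lact tri_diagM. Qed.
Lemma prU_lact a x : prU (lact a x) = prK x *: tri_u a + tri_diag a 0 v1 *: prU x.
Proof. by rewrite /prU component_lact tri_uM. Qed.
Lemma prW_lact a x :
  prW (lact a x) = prK x *: tri_w a + tri_diag a 0 v2 *: prW x + bact b (tri_b a) (prU x).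
Proof. by rewrite /prW component_lact tri_wM. Qed.

Lemma prK_z0 : prK z0 = 1. Proof. by rewrite /prK component_z0 tri_diag_e. Qed.
Lemma prU_z0 : prU z0 = 0. Proof. by rewrite /prU component_z0. Qed.
Lemma prW_z0 : prW z0 = 0. Proof. by rewrite /prW component_z0. Qed.

(** The inclusions of [U] and [W] in the projective module. *)
Definition embU_fun (u : U) : P := lact (Tri b 0 u 0 0) z0.
Definition embW_fun (w : W) : P := lact (Tri b 0 0 0 w) z0.

Lemma prK_embU_fun u : prK (embU_fun u) = 0. Proof. by rewrite prK_lact mxE mul0r. Qed.
Lemma prU_embU_fun u : prU (embU_fun u) = u.
Proof. by rewrite prU_lact prK_z0 prU_z0 scaler0 addr0 scale1r. Qed.
Lemma prW_embU_fun u : prW (embU_fun u) = 0.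
Proof. by rewrite prW_lact prW_z0 prU_z0 !scaler0 bact0r !addr0. Qed.
Lemma prK_embW_fun w : prK (embW_fun w) = 0. Proof. by rewrite prK_lact mxE mul0r. Qed.
Lemma prU_embW_fun w : prU (embW_fun w) = 0.
Proof. by rewrite prU_lact prU_z0 !scaler0 addr0. Qed.
Lemma prW_embW_fun w : prW (embW_fun w) = w.
Proof. by rewrite prW_lact prK_z0 prW_z0 prU_z0 bact0r scaler0 !addr0 scale1r. Qed.

Lemma embU_linear : linear embU_fun.
Proof.
by move=> c x y; apply: pr_inj; rewrite linearP /= ?prK_embU_fun ?prU_embU_fun
  ?prW_embU_fun ?scaler0 ?addr0.
Qed.
Lemma embW_linear : linear embW_fun.
Proof.
by move=> c x y; apply: pr_inj; rewrite linearP /= ?prK_embW_fun ?prU_embW_fun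
  ?prW_embW_fun ?scaler0 ?addr0.
Qed.
HB.instance Definition _ := GRing.isLinear.Build K U P *:%R embU_fun embU_linear.
HB.instance Definition _ := GRing.isLinear.Build K W P *:%R embW_fun embW_linear.
Definition embU : 'Hom(U, P) := linfun embU_fun.
Definition embW : 'Hom(W, P) := linfun embW_fun.

Lemma prK_embU u : prK (embU u) = 0.
Proof. by rewrite [embU _]lfunE; apply: prK_embU_fun. Qed.
Lemma prU_embU u : prU (embU u) = u.
Proof. by rewrite [embU _]lfunE; apply: prU_embU_fun. Qed.
Lemma prW_embU u : prW (embU u) = 0.
Proof. by rewrite [embU _]lfunE; apply: prW_embU_fun. Qed.
Lemma prK_embW w : prK (embW w) = 0.
Proof. by rewrite [embW _]lfunE; apply: prK_embW_fun. Qed.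
Lemma prU_embW w : prU (embW w) = 0.
Proof. by rewrite [embW _]lfunE; apply: prU_embW_fun. Qed.
Lemma prW_embW w : prW (embW w) = w.
Proof. by rewrite [embW _]lfunE; apply: prW_embW_fun. Qed.

Definition prE := (prK_embU, prU_embU, prW_embU, prK_embW, prU_embW, prW_embW,
  prK_z0, prU_z0, prW_z0).

Lemma pr_decomp x : x = (prK x : K) *: z0 + embU (prU x) + embW (prW x).
Proof.
apply: pr_inj; rewrite !linearD !linearZ /= !prE ?scaler0 ?addr0 ?add0r //.
exact/esym/mulr1.
Qed.

Lemma mem_z0 x : (x \in <[z0]>%VS) = (prU x == 0) && (prW x == 0).
Proof.
apply/idP/andP => [/vlineP[c ->]|[/eqP xU /eqP xW]].
  by rewrite !linearZ /= !prE !scaler0 eqxx.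
by rewrite (pr_decomp x) xU xW !linear0 !addr0 memvZ // memv_line.
Qed.

Lemma mem_embU x : (x \in limg embU) = (prK x == 0) && (prW x == 0).
Proof.
apply/memv_imgP/andP => [[u _ ->]|[/eqP xK /eqP xW]]; first by rewrite !prE eqxx.
by exists (prU x); rewrite ?memvf // {1}(pr_decomp x) xK xW linear0 scale0r add0r addr0.
Qed.

Lemma mem_embW x : (x \in limg embW) = (prK x == 0) && (prU x == 0).
Proof.
apply/memv_imgP/andP => [[u _ ->]|[/eqP xK /eqP xU]]; first by rewrite !prE eqxx.
by exists (prW x); rewrite ?memvf // {1}(pr_decomp x) xK xU linear0 scale0r !add0r.
Qed.

Lemma mem_embU_line u x : (x \in <[embU u]>%VS) = [&& prK x == 0, prW x == 0 & prU x \in <[u]>%VS].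
Proof.
apply/vlineP/and3P => [[c ->]|[/eqP xK /eqP xW /vlineP[c xU]]].
  by rewrite !linearZ /= !prE !scaler0 eqxx memvZ ?memv_line.
exists c; rewrite (pr_decomp x) xK xW xU linear0 scale0r add0r addr0.
by rewrite linearZ.
Qed.

Lemma mem_embW_line w x : (x \in <[embW w]>%VS) = [&& prK x == 0, prU x == 0 & prW x \in <[w]>%VS].
Proof.
apply/vlineP/and3P => [[c ->]|[/eqP xK /eqP xU /vlineP[c xW]]].
  by rewrite !linearZ /= !prE !scaler0 eqxx memvZ ?memv_line.
exists c; rewrite (pr_decomp x) xK xU xW linear0 scale0r !add0r.
by rewrite linearZ.
Qed.

Lemma embU_inj : injective embU.
Proof. by move=> u v /(congr1 prU); rewrite !prE. Qed.
Lemma embW_inj : injective embW.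
Proof. by move=> u v /(congr1 prW); rewrite !prE. Qed.

Lemma dim_embU : \dim (limg embU) = \dim {: U}.
Proof. by apply: limg_dim_eq; rewrite (eqP (introT lker0P embU_inj)) capv0. Qed.
Lemma dim_embW : \dim (limg embW) = \dim {: W}.
Proof. by apply: limg_dim_eq; rewrite (eqP (introT lker0P embW_inj)) capv0. Qed.

Lemma z0_neq0 : z0 != 0.
Proof. by apply/eqP => /(congr1 prK)/eqP; rewrite prE linear0 oner_eq0. Qed.

Lemma dim_P : \dim {: P} = (1 + \dim {: U} + \dim {: W})%N.
Proof.
have -> : {: P}%VS = (<[z0]> + limg embU + limg embW)%VS.
  apply/eqP; rewrite eqEsubv subvf andbT; apply/subvP => x _.
  rewrite (pr_decomp x) !memv_add ?memv_img ?memvf //.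
  by rewrite memvZ ?memv_line.
rewrite dimv_disjoint_sum; last first.
  apply/eqP; rewrite -subv0; apply/subvP => x; rewrite memv_cap mem_embW.
  case/andP=> /memv_addP[y + [z + ->]]; rewrite mem_z0 mem_embU => /andP[yU yW] /andP[zK zW].
  case/andP; rewrite !linearD /= (eqP yU) (eqP zK) add0r addr0 => yK zU.
  by rewrite memv0; apply/eqP/pr_inj; rewrite !linearD !linear0 /= ?(eqP yU) ?(eqP yW)
    ?(eqP yK) ?(eqP zU) ?(eqP zW) ?(eqP zK) addr0.
rewrite dimv_disjoint_sum ?dim_vline ?z0_neq0 ?dim_embU ?dim_embW //.
apply/eqP; rewrite -subv0; apply/subvP => x; rewrite memv_cap mem_embU mem_z0.
case/andP=> /andP[xU xW] /andP[xK _]; rewrite memv0.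
by apply/eqP/pr_inj; rewrite !linear0 (eqP xU, eqP xW, eqP xK).
Qed.

(** The part of the projective module at the vertex [i]. *)
Definition tri_part (i : 'I_3) : {vspace P} :=
  if i == v0 then <[z0]>%VS else if i == v1 then limg embU else limg embW.

Lemma limg_lact_e i : limg (linfun (lact (e i) : P -> P)) = tri_part i.
Proof.
have lactE0 x : lact (e v0) x = (prK x : K) *: z0.
  apply: pr_inj; rewrite linearZ /= ?prK_lact ?prU_lact ?prW_lact !tri_diag_e !prE.
  - by rewrite mul1r; apply/esym/mulr1.
  - by rewrite !scaler0 scale0r addr0.
  - by rewrite !scaler0 scale0r !add0r bact0l.
have lactE1 x : lact (e v1) x = embU (prU x).
  apply: pr_inj; rewrite ?prK_lact ?prU_lact ?prW_lact !tri_diag_e !prE.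
  - by rewrite mul0r.
  - by rewrite scaler0 add0r scale1r.
  - by rewrite scaler0 scale0r !add0r bact0l.
have lactE2 x : lact (e v2) x = embW (prW x).
  apply: pr_inj; rewrite ?prK_lact ?prU_lact ?prW_lact !tri_diag_e !prE.
  - by rewrite mul0r.
  - by rewrite scaler0 add0r scale0r.
  - by rewrite scaler0 scale1r add0r bact0l addr0.
apply/vspaceP => x; move: i; apply: ord3P; rewrite /tri_part /=.
- apply/memv_imgP/vlineP => [[y _ ->]|[c ->]].
    by exists (prK y); rewrite (lfunE (lact _)) /= lactE0.
  exists (c *: z0); rewrite ?memvf // (lfunE (lact _)) /= lactE0; congr (_ *: _).
  by rewrite linearZ /= prE; apply/esym/mulr1.
- apply/memv_imgP/memv_imgP => [[y _ ->]|[u _ ->]].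
    by exists (prU y); rewrite ?memvf // (lfunE (lact _)) /= lactE1.
  by exists (embU u); rewrite ?memvf // (lfunE (lact _)) /= lactE1 !prE.
- apply/memv_imgP/memv_imgP => [[y _ ->]|[w _ ->]].
    by exists (prW y); rewrite ?memvf // (lfunE (lact _)) /= lactE2.
  by exists (embW w); rewrite ?memvf // (lfunE (lact _)) /= lactE2 !prE.
Qed.

Lemma rad_projTP x : rad_projT x <-> prK x = 0.
Proof.
split=> [[s [sJ ->]]|x0].
  rewrite linear_sum big1_seq //= => u us; rewrite prK_lact.
  by rewrite (tri_diag_jacobson (sJ _ us)) mul0r.
exists [:: (Tri b 0 (prU x) 0 (prW x), z0)]; split.
  by move=> u; rewrite inE => /eqP -> /=; apply: tri_jacobson.
rewrite big_seq1 /=; apply: pr_inj.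
- by rewrite prK_lact mxE mul0r.
- by rewrite prU_lact prE mxE scale0r addr0 scale1r.
- by rewrite prW_lact !prE mxE scale0r bact0l !addr0 scale1r.
Qed.

End TriModuli.

Section TriModuliMax.
Variables (K : fieldType) (U W : vectType K) (n : nat) (b : 'I_n -> 'Hom(U, W)).
Local Notation tri := (tri b).
Local Notation e := (tri_e b).
Local Notation t := tri_top.
Local Notation P := (projT e t).
Local Notation z0 := (z0 b).
Local Notation prE := (prE b).

(** The dimension vector for which the submodules have one dimension at each of
    the vertices [1] and [2]. *)
Definition tri_dvec (i : 'I_3) : nat :=
  (if i == v0 then 1 else if i == v1 then \dim {: U} - 1 else \dim {: W} - 1)%N.

(** The plane spanned by [u] and [w], a submodule when all [b j u] lie in [<w>]. *)
Definition point_submod (u : U) (w : W) : {vspace P} := (<[embU b u]> + <[embW b w]>)%VS.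

Lemma embU_embW_disjoint u w : (<[embU b u]> :&: <[embW b w]> = 0)%VS.
Proof.
apply/eqP; rewrite -subv0; apply/subvP => x; rewrite memv_cap mem_embU_line mem_embW_line.
case/andP=> /and3P[/eqP xK /eqP xW _] /and3P[_ /eqP xU _].
by rewrite memv0; apply/eqP/pr_inj; rewrite !linear0.
Qed.

Lemma dim_point_submod u w : u != 0 -> w != 0 -> \dim (point_submod u w) = 2%N.
Proof.
move=> u0 w0; rewrite dimv_disjoint_sum ?embU_embW_disjoint // !dim_vline.
have -> : embU b u != 0 by rewrite -(linear0 (embU b)) (inj_eq (@embU_inj _ _ _ _ b)).
by have -> : embW b w != 0 by rewrite -(linear0 (embW b)) (inj_eq (@embW_inj _ _ _ _ b)).
Qed.

Lemma mem_point_submod u w x : (x \in point_submod u w) =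
  [&& prK x == 0, prU x \in <[u]>%VS & prW x \in <[w]>%VS].
Proof.
apply/memv_addP/and3P => [[y + [z + ->]]|[xK xU xW]].
  rewrite mem_embU_line mem_embW_line => /and3P[/eqP yK /eqP yW yU] /and3P[/eqP zK /eqP zU zW].
  by rewrite !linearD /= yK yW zK zU !addr0 add0r eqxx.
exists (embU b (prU x)); first by rewrite mem_embU_line !prE !eqxx xU.
exists (embW b (prW x)); first by rewrite mem_embW_line !prE !eqxx xW.
by rewrite {1}(pr_decomp x) (eqP xK) scale0r add0r.
Qed.

Hypotheses (U0 : (0 < \dim {: U})%N) (W0 : (0 < \dim {: W})%N).

Lemma tri_dvec_sum : (\sum_i tri_dvec i + 2 = \dim {: P})%N.
Proof.
rewrite !big_ord_recl big_ord0 dim_P /tri_dvec /= addn0.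
by rewrite -{2}(subnK U0) -{2}(subnK W0) !addnA; do !rewrite ?addn1 ?addn2 ?addSn ?addnS.
Qed.

Lemma tri_part_dim i : \dim (tri_part b i) = if i == v0 then 1%N else (tri_dvec i).+1.
Proof.
move: i; apply: ord3P; rewrite /tri_part /tri_dvec /=.
- by rewrite dim_vline z0_neq0.
- by rewrite dim_embU subn1 prednK.
- by rewrite dim_embW subn1 prednK.
Qed.

Lemma dimv1_line (vT : vectType K) (M : {vspace vT}) : \dim M = 1%N ->
  exists2 v, v != 0 & M = <[v]>%VS.
Proof.
move=> dM; have M0 : M != 0%VS by rewrite -dimv_eq0 dM.
exists (vpick M); first by rewrite vpick0.
by apply/esym/eqP; rewrite eqEdim -memvE memv_pick dM dim_vline vpick0 M0.
Qed.

(** A submodule of the radical with this dimension vector meets each of [U] and [W]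
    in a line; the action of the arrows sends the first line into the second. *)
Lemma tri_grassT C : grassT (e := e) (t := t) tri_dvec C <->
  exists u w, [/\ u != 0, w != 0, C = point_submod u w & forall j, b j u \in <[w]>%VS].
Proof.
split=> [[dimC subC radC dvecC]|[u [w [u0 w0 -> buw]]]].
  have dC : \dim C = 2%N.
    by apply/eqP; rewrite -(eqn_add2r (\sum_i tri_dvec i)) dimC -tri_dvec_sum addnC.
  have capC i : i != v0 -> \dim (tri_part b i :&: C) = 1%N.
    move=> i0; have := dimv_sum_cap (tri_part b i) C.
    rewrite -limg_lact_e dvecC limg_lact_e tri_part_dim (negPf i0) dC.
    by rewrite addSn -addnS -addnA => /addnI; apply: (@addnI 2).
  have [y y0 Ey] := dimv1_line (capC v1 isT).
  have [z z0' Ez] := dimv1_line (capC v2 isT).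
  have : y \in (tri_part b v1 :&: C)%VS by rewrite Ey memv_line.
  have : z \in (tri_part b v2 :&: C)%VS by rewrite Ez memv_line.
  rewrite !memv_cap => /andP[/memv_imgP[w _ zE] zC] /andP[/memv_imgP[u _ yE] yC].
  have u0 : u != 0 by apply: contraNneq y0 => u0; rewrite yE u0 linear0.
  have w0 : w != 0 by apply: contraNneq z0' => w0; rewrite zE w0 linear0.
  exists u, w; split=> //.
    apply/esym/eqP; rewrite eqEdim dim_point_submod // dC leqnn andbT.
    by rewrite subv_add -!memvE -yE -zE yC zC.
  move=> j; pose bj : tri := Tri b 0 0 (delta_mx 0 j) 0.
  have Ebj : lact bj y = embW b (b j u).
    apply: pr_inj; rewrite yE ?prK_lact ?prU_lact ?prW_lact !prE.
    - by rewrite mulr0.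
    - by rewrite scale0r add0r mxE scale0r.
    rewrite scale0r add0r linear0 add0r /bact (bigD1 j) //= mxE !eqxx scale1r big1 ?addr0 //.
    by move=> k kj; rewrite mxE (negPf kj) andbF scale0r.
  have : embW b (b j u) \in (tri_part b v2 :&: C)%VS.
    by rewrite memv_cap memv_img ?memvf //= -Ebj subC.
  by rewrite Ez zE mem_embW_line !prE => /and3P[].
split.
- by rewrite dim_point_submod // -tri_dvec_sum addnC.
- move=> a x; rewrite !mem_point_submod => /and3P[/eqP xK xU xW].
  rewrite prK_lact prU_lact prW_lact xK mulr0 !scale0r !add0r eqxx memvZ //=.
  rewrite memvD ?memvZ //; rewrite /bact; apply: memv_suml => j _; apply: memvZ.
  by case/vlineP: xU => c ->; rewrite linearZ memvZ ?buw.
- by move=> x; rewrite mem_point_submod => /and3P[/eqP xK _ _]; apply/rad_projTP.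
move=> i; rewrite limg_lact_e; have := dimv_sum_cap (tri_part b i) (point_submod u w).
have -> : \dim (tri_part b i :&: point_submod u w) = if i == v0 then 0%N else 1%N.
  have embu0 : embU b u != 0 by rewrite -(linear0 (embU b)) (inj_eq (@embU_inj _ _ _ _ b)).
  have embw0 : embW b w != 0 by rewrite -(linear0 (embW b)) (inj_eq (@embW_inj _ _ _ _ b)).
  move: i; apply: ord3P; rewrite /tri_part /=.
  - apply/eqP; rewrite dimv_eq0 -subv0; apply/subvP => x.
    rewrite memv_cap mem_z0 mem_point_submod => /andP[/andP[/eqP xU /eqP xW] /andP[/eqP xK _]].
    by rewrite memv0; apply/eqP/pr_inj; rewrite ?xK ?xU ?xW linear0.
  - suff -> : (limg (embU b) :&: point_submod u w)%VS = <[embU b u]>%VS by rewrite dim_vline embu0.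
    apply/vspaceP => x.
    rewrite memv_cap mem_embU mem_point_submod mem_embU_line.
    by case: eqP => //= _; case: eqP => //= ->; rewrite mem0v andbT.
  - suff -> : (limg (embW b) :&: point_submod u w)%VS = <[embW b w]>%VS by rewrite dim_vline embw0.
    apply/vspaceP => x.
    rewrite memv_cap mem_embW mem_point_submod mem_embW_line.
    by case: eqP => //= _; case: eqP => //= ->; rewrite mem0v.
rewrite tri_part_dim; case: eqP => [->|_]; first by rewrite addn0.
by rewrite addn1 addSn => -[].
Qed.

Lemma lact_z0 (x : P) : exists a, x = lact a z0.
Proof.
exists (Tri b (prK x *: delta_mx 0 v0) (prU x) 0 (prW x)).
apply: pr_inj; rewrite ?prK_lact ?prU_lact ?prW_lact !prE.
- by rewrite !mxE !eqxx /= !mulr1.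
- by rewrite scale1r scaler0 addr0.
- by rewrite scale1r scaler0 bact0r !addr0.
Qed.

(** An endomorphism of [P] is determined by the image of the generator. *)
Lemma module_hom_z0 (f : 'End(P)) c :
  module_hom f -> f z0 = c *: z0 -> forall x, f x = c *: x.
Proof. by move=> fM fz x; have [a ->] := lact_z0 x; rewrite fM fz linearZ. Qed.

(** The group acts through scalars: the Borel subgroup of the top is
    one-dimensional, and no nonzero map from [P] to its radical exists, as the
    quiver has no oriented cycle. *)
Lemma borel_unip_scalar g : borel_unip (e := e) (t := t) g ->
  exists2 c, c != 0 & forall x, g x = c *: x.
Proof.
case=> b' [u [[[[bM kerb] _] bor] [f [fM frad ->]] ->]].
have : b' z0 \in (\sum_(l < t v0 | (l <= 0)%N) <[zgen e l]>)%VS := bor v0 _.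
rewrite (big_pred1 (Ordinal (isT : 0 < t v0)%N)) => [/vlineP[c bz]|l]; last first.
  by rewrite /= leqn0.
have f0 x : f x = 0.
  rewrite (module_hom_z0 (c := 0)) ?scale0r //.
  have -> : z0 = lact (e v0) z0.
    by apply: component_inj; rewrite component_lact component_z0 tri_e_orth eqxx.
  rewrite fM; apply: pr_inj; rewrite ?prK_lact ?prU_lact ?prW_lact linear0.
  - by rewrite (rad_projTP _).1 ?mulr0.
  - by rewrite !tri_diag_e /= !scale0r addr0 linear0.
  - by rewrite !tri_diag_e /= !scale0r bact0l !addr0 linear0.
exists c => [|x].
  apply: contraTneq (z0_neq0 b) => c0; rewrite negbK -memv0 -(eqP kerb) memv_ker.
  by rewrite bz c0 scale0r.
by rewrite comp_lfunE add_lfunE id_lfunE f0 addr0; apply: module_hom_z0.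
Qed.

Lemma scalar_stab (C : {vspace P}) (g : 'End(P)) c :
  c != 0 -> (forall x, g x = c *: x) -> stab C g.
Proof.
move=> c0 gE; have kerg : lker g == 0%VS.
  apply/lker0P => x y; rewrite !gE; exact: scalerI.
split; first by split=> // a x; rewrite !gE linearZ.
apply/eqP; rewrite eqEdim limg_dim_eq ?(eqP kerg) ?capv0 // leqnn andbT.
by apply/subvP => _ /memv_imgP[x xC ->]; rewrite gE memvZ.
Qed.

Lemma tri_moduli_max C : moduli_max e t tri_dvec C <->
  exists u w, [/\ u != 0, w != 0, C = point_submod u w & forall j, b j u \in <[w]>%VS].
Proof.
rewrite -tri_grassT; split=> [[]//|gC]; split=> // g /borel_unip_scalar[c c0].
exact: scalar_stab.
Qed.

End TriModuliMax.

(** * Pluecker coordinates of planes *)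

Lemma det_mx22 (R : comNzRingType) (A : 'M[R]_2) :
  \det A = A 0 0 * A 1 1 - A 1 0 * A 0 1.
Proof.
rewrite (expand_det_row _ ord0) !big_ord_recl big_ord0 /cofactor !det_mx11 !mxE /=.
rewrite expr0 expr1 mul1r addr0 mulN1r mulrN [A 1 0 * _]mulrC.
by congr (A _ _ * A _ _ - A _ _ * A _ _); apply: val_inj.
Qed.

Section Planes.
Variables (K : fieldType) (vT : vectType K).
Local Notation N := (\dim {: vT}).
Local Notation ix := (incr_fun 2 N).
Implicit Types (y z : vT) (s : ix).

Let i0 : 'I_2 := 0.
Let i1 : 'I_2 := 1.

Local Notation crd i y := (coord (vbasis {: vT}) i y).

(** The two-by-two minor in the columns [s] of the coordinates of [y] and [z]. *)
Definition minor2 y z s : K :=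
  crd (val s i0) y * crd (val s i1) z - crd (val s i1) y * crd (val s i0) z.

(** The Pluecker vector of an ordered pair of vectors. *)
Definition plane_vec y z : 'rV[K]_#|{: ix}| := \row_j minor2 y z (enum_val j).

Lemma plane_vec_comb y z a b c d :
  plane_vec (a *: y + b *: z) (c *: y + d *: z) = (a * d - b * c) *: plane_vec y z.
Proof.
apply/rowP => j; rewrite !mxE /minor2 !linearD !linearZ /=.
set s := val (enum_val j); set y0 := crd _ y; set y1 := crd (s i1) y.
set w0 := crd (s i0) z; set w1 := crd (s i1) z.
change ((a * y0 + b * w0) * (c * y1 + d * w1) - (a * y1 + b * w1) * (c * y0 + d * w0)
  = (a * d - b * c) * (y0 * w1 - y1 * w0)).
by ring.
Qed.

Lemma plane_vec_mem y z y' z' : y' \in (<[y]> + <[z]>)%VS -> z' \in (<[y]> + <[z]>)%VS ->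
  plane_vec y' z' \in <[plane_vec y z]>%VS.
Proof.
case/memv_addP=> _ /vlineP[a ->] [_ /vlineP[b ->] ->].
case/memv_addP=> _ /vlineP[c ->] [_ /vlineP[d ->] ->].
by rewrite plane_vec_comb memvZ ?memv_line.
Qed.

(** Any two vectors that span a plane can replace the basis [vbasis] of the plane. *)
Lemma plane_pluecker_pt y z : \dim (<[y]> + <[z]>)%VS = 2%N ->
  pluecker_pt 2 (<[y]> + <[z]>)%VS = <[plane_vec y z]>%VS.
Proof.
set C := (<[y]> + <[z]>)%VS => dC.
pose c0 := (vbasis C)`_0; pose c1 := (vbasis C)`_1.
have EC : C = (<[c0]> + <[c1]>)%VS.
  rewrite -[LHS](span_basis (vbasisP C)) /c0 /c1.
  have := size_tuple (vbasis C); rewrite {2}dC; case: (tval (vbasis C)) => [|u [|v []]] //= _.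
  by rewrite span_cons span_seq1.
have -> : pluecker_pt 2 C = <[plane_vec c0 c1]>%VS.
  congr (<[_]>)%VS; apply/rowP => j; rewrite !mxE /pluecker_coord.
  by rewrite det_mx22 !mxE /minor2; congr (_ - _); apply: mulrC.
apply/eqP; rewrite eqEsubv -!memvE !plane_vec_mem //.
- by rewrite -EC -/C; apply: subvP (addvSl _ _) _ (memv_line _).
- by rewrite -EC -/C; apply: subvP (addvSr _ _) _ (memv_line _).
- by rewrite -/C EC; apply: subvP (addvSl _ _) _ (memv_line _).
- by rewrite -/C EC; apply: subvP (addvSr _ _) _ (memv_line _).
Qed.

(** Increasing maps from a set of two elements correspond to pairs [i < j]. *)
Lemma incr_pair_count (i j : 'I_N) :
  \sum_(s : ix) ((val s i0 == i) && (val s i1 == j))%:R = (i < j)%N%:R :> K.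
Proof.
have s01 s : (val s i0 < val s i1)%N.
  by have /forallP/(_ i0)/forallP/(_ i1) := valP s.
have [lt_ij|] := ltnP i j; last first.
  move=> le_ji; rewrite big1 // => s _; case: andP => // -[/eqP Ei /eqP Ej].
  by move: (s01 s); rewrite Ei Ej ltnNge le_ji.
pose f : {ffun 'I_2 -> 'I_N} := [ffun k => if k == i0 then i else j].
have incf : [forall k : 'I_2, forall l : 'I_2, (k < l)%N ==> (f k < f l)%N].
  apply/forallP => k; apply/forallP => l; apply/implyP; rewrite !ffunE.
  by case: k l => [[|[|//]] ?] [[|[|//]] ?].
rewrite (bigD1 (exist _ f incf : ix)) //= !ffunE /= !eqxx big1 ?addr0 // => s ns.
case: andP => // -[/eqP Ei /eqP Ej]; case/eqP: ns; apply: val_inj; apply/ffunP => k /=.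
rewrite ffunE; case: eqP => [->|k0]; first by [].
rewrite -Ej; congr (_ _); apply: val_inj; case: k k0 => -[|[|//]] //= lt k0.
by case: k0; apply: val_inj.
Qed.

(** The two-by-two case of the Cauchy-Binet formula: a minor with respect to any two
    functionals is linear in the Pluecker vector. *)
Lemma plane_vec_functional (h h' : 'Hom(vT, K^o)) :
  exists c : 'rV[K]_#|{: ix}|, forall y z,
    \sum_j c 0 j * plane_vec y z 0 j = h y * h' z - h z * h' y.
Proof.
pose v i := (vbasis {: vT})`_i.
pose m (f g : 'I_N -> K) i j := f i * g j - f j * g i.
pose c s := m (fun i => h (v i)) (fun i => h' (v i)) (val s i0) (val s i1).
exists (\row_(j < #|{: ix}|) c (enum_val j)) => y z.
pose F i j := m (fun i => h (v i)) (fun i => h' (v i)) i j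
  * m (fun i => crd i y) (fun i => crd i z) i j.
have -> : \sum_j (\row_(j < #|{: ix}|) c (enum_val j)) 0 j * plane_vec y z 0 j
    = \sum_(s : ix) F (val s i0) (val s i1).
  rewrite [RHS](reindex (@enum_val _ {: ix})) /=; last first.
    by apply: onW_bij; apply: enum_val_bij.
  by apply: eq_bigr => j _; rewrite !mxE.
have -> : \sum_(s : ix) F (val s i0) (val s i1) = \sum_i \sum_j F i j * (i < j)%N%:R.
  transitivity (\sum_(s : ix) \sum_i \sum_j F i j * ((val s i0 == i) && (val s i1 == j))%:R).
    apply: eq_bigr => s _; rewrite (bigD1 (val s i0)) //= (bigD1 (val s i1)) //= !eqxx mulr1.
    rewrite !big1 ?addr0 // => [i ni|j js]; last by rewrite eq_sym (negPf js) mulr0.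
    by rewrite big1 // => j _; rewrite eq_sym (negPf ni) mulr0.
  rewrite exchange_big; apply: eq_bigr => i _; rewrite exchange_big; apply: eq_bigr => j _.
  by rewrite -mulr_sumr incr_pair_count.
have hE (f : 'Hom(vT, K^o)) x : f x = \sum_i crd i x * f (v i).
  rewrite {1}(coord_vbasis (memvf x)) linear_sum; apply: eq_bigr => i _.
  by rewrite linearZ.
(* Each product of sums is a sum over all pairs; opposite pairs are grouped. *)
pose G (i j : 'I_N) : K := h (v i) * h' (v j) * m (fun i => crd i y) (fun i => crd i z) i j.
have -> : h y * h' z - h z * h' y = \sum_i \sum_j G i j.
  rewrite !hE !big_distrlr -sumrB; apply: eq_bigr => i _; rewrite -sumrB.
  by apply: eq_bigr => j _; rewrite /G /m /=; ring.
have FG i j : F i j = G i j + G j i by rewrite /F /G /m /=; ring.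
under eq_bigr do under eq_bigr do rewrite FG mulrDl.
under eq_bigr do rewrite big_split; rewrite big_split /= [X in _ + X]exchange_big -big_split.
apply: eq_bigr => i _; rewrite -big_split; apply: eq_bigr => j _ /=.
rewrite -mulrDr; case: (ltngtP i j) => [_|_|/val_inj ->]; rewrite ?addr0 ?add0r ?mulr1 //.
by rewrite mulr0 /G /m subrr mulr0.
Qed.

End Planes.

(** * The Veronese algebra of a projective set *)

Lemma line_eqZ (K : fieldType) (vT : vectType K) (c : K) (v : vT) :
  c != 0 -> (<[c *: v]> = <[v]>)%VS.
Proof.
move=> c0; apply/eqP; rewrite eqEsubv -!memvE memvZ ?memv_line //=.
by rewrite -{1}[v](scalerK c0) memvZ ?memv_line.
Qed.

Lemma line_eqP (K : fieldType) (vT : vectType K) (v w : vT) :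
  v != 0 -> <[v]>%VS = <[w]>%VS -> exists2 c, c != 0 & v = c *: w.
Proof.
move=> v0 vw; have : v \in <[w]>%VS by rewrite -vw memv_line.
by case/vlineP=> c Ev; exists c => //; apply: contraNneq v0 => c0; rewrite Ev c0 scale0r.
Qed.

Lemma vpick_line (K : fieldType) (vT : vectType K) (v : vT) :
  v != 0 -> exists2 c, c != 0 & vpick <[v]>%VS = c *: v.
Proof.
move=> v0; have /vlineP[c Ec] := memv_pick <[v]>%VS; exists c => //.
apply: contraNneq v0 => c0; have : vpick <[v]>%VS == 0 by rewrite Ec c0 scale0r.
by rewrite vpick0 -dimv_eq0 dim_vline; case: (v == 0).
Qed.

Section VeroneseAlgebra.
Variables (K : fieldType) (n : nat) (E : nat) (X : 'rV[K]_n -> Prop).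
Hypothesis X_neq0 : forall x, X x -> x != 0.
(** [X] is cut out by forms of degree [E + 1]. *)
Hypothesis X_eqs : forall x, x != 0 ->
  (forall p : {mpoly K[n]}, p \is E.+1.-homog -> (forall y, X y -> meval_row p y = 0) ->
     meval_row p x = 0) -> X x.

(** Veronese tensors of points of [X] that span all of them. *)
Variable gens : seq (tensor K n E.+1).
Hypothesis gensP : forall u, u \in gens -> exists x, X x /\ u = veronese E.+1 x.
Hypothesis gens_span : forall u, (exists x, X x /\ u = veronese E.+1 x) -> u \in <<gens>>%VS.

(** The span of the Veronese tensors of degree [E + 1] of the points of [X]. *)
Definition ver_U : {vspace tensor K n E.+1} := <<gens>>%VS.
(** The sum of the contractions of [ver_U]. *)
Definition ver_W : {vspace tensor K n E} := (\sum_(j < n) contract K E j @: ver_U)%VS.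
Local Notation U := (subvs_of ver_U).
Local Notation W := (subvs_of ver_W).

(** The contractions as maps from [ver_U] to [ver_W]. *)
Definition ver_b (j : 'I_n) : 'Hom(U, W) :=
  (linfun (vsproj ver_W) \o contract K E j \o linfun vsval)%VF.

Lemma contract_ver_W j y : y \in ver_U -> contract K E j y \in ver_W.
Proof.
move=> yU; have jW : (contract K E j @: ver_U <= ver_W)%VS by exact: (sumv_sup j).
by apply: (subvP jW); rewrite memv_img.
Qed.

Lemma ver_bE j u : vsval (ver_b j u) = contract K E j (vsval u).
Proof.
rewrite comp_lfunE (lfunE (@vsval _ _ ver_U)) comp_lfunE (lfunE (vsproj ver_W)) /=.
by rewrite vsprojK ?contract_ver_W ?subvsP.
Qed.

Lemma ver_b_full : (\sum_j limg (ver_b j) = fullv)%VS.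
Proof.
apply/eqP; rewrite eqEsubv subvf; apply/subvP => w _.
have /memv_sumP[v vP Ew] := subvsP w.
have -> : w = \sum_j vsproj ver_W (v j).
  apply: val_inj; rewrite /= linear_sum Ew; apply: eq_bigr => j _; rewrite /= vsprojK //.
  by have /memv_imgP[u uU ->] := vP j isT; apply: contract_ver_W.
apply: memv_sumr => j _; have /memv_imgP[u uU ->] := vP j isT.
suff -> : vsproj ver_W (contract K E j u) = ver_b j (vsproj ver_U u).
  by rewrite memv_img ?memvf.
by apply: val_inj; rewrite /= ver_bE !vsprojK ?contract_ver_W.
Qed.

Lemma ver_U_veronese x : X x -> veronese E.+1 x \in ver_U.
Proof. by move=> Xx; apply: gens_span; exists x. Qed.

Lemma ver_W_veronese x : X x -> veronese E x \in ver_W.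
Proof.
move=> Xx; have /rV0Pn[j xj0] := X_neq0 Xx.
rewrite -[veronese E x](scalerK xj0) memvZ // -contract_veronese.
exact/contract_ver_W/ver_U_veronese.
Qed.

(** The Veronese tensors of a point, as elements of [ver_U] and [ver_W] when the
    point is in [X]. *)
Definition ver_u (x : 'rV[K]_n) : U := vsproj ver_U (veronese E.+1 x).
Definition ver_w (x : 'rV[K]_n) : W := vsproj ver_W (veronese E x).

Lemma val_ver_u x : X x -> vsval (ver_u x) = veronese E.+1 x.
Proof. by move=> Xx; rewrite vsprojK ?ver_U_veronese. Qed.
Lemma val_ver_w x : X x -> vsval (ver_w x) = veronese E x.
Proof. by move=> Xx; rewrite vsprojK ?ver_W_veronese. Qed.

Lemma ver_u_neq0 x : X x -> ver_u x != 0.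
Proof.
move=> Xx; apply: contraNneq (veronese_neq0 E.+1 (X_neq0 Xx)) => u0.
by rewrite -val_ver_u // u0 linear0.
Qed.
Lemma ver_w_neq0 x : X x -> ver_w x != 0.
Proof.
move=> Xx; apply: contraNneq (veronese_neq0 E (X_neq0 Xx)) => w0.
by rewrite -val_ver_w // w0 linear0.
Qed.

Lemma ver_span (y : tensor K n E.+1) : y \in ver_U ->
  exists2 c : 'I_(size gens) -> K, y = \sum_i c i *: gens`_i
  & forall i : 'I_(size gens), exists x, X x /\ gens`_i = veronese E.+1 x.
Proof.
move=> yU; exists (fun i => coord (in_tuple gens) i y); first exact: coord_span.
by move=> i; apply: (gensP (mem_nth 0 (ltn_ord i))).
Qed.

Lemma ver_U_symmetric (y : tensor K n E.+1) : y \in ver_U -> symmetric_tensor y.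
Proof.
case/ver_span=> c -> gensX s t st; rewrite !sum_ffunE; apply: eq_bigr => i _.
by rewrite !ffunE; have [x [_ ->]] := gensX i; rewrite (veronese_symmetric x st).
Qed.

(** Forms of degree [E + 1] that vanish on [X] are functionals that vanish on
    [ver_U]. *)
Lemma ver_U_point c x : x != 0 -> c != 0 -> c *: veronese E.+1 x \in ver_U -> X x.
Proof.
move=> x0 c0 /ver_span[a Ea gensX]; apply: X_eqs => // p homp pX.
have [h hE] := form_linear homp; apply: (mulfI c0); rewrite hE mulr0.
have -> : c * h (veronese E.+1 x) = h (c *: veronese E.+1 x) by rewrite linearZ.
rewrite Ea linear_sum big1 // => i _; have [y [Xy ->]] := gensX i.
by rewrite linearZ /= -hE pX //; apply: mulr0.
Qed.

Local Notation e := (tri_e ver_b).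
Local Notation P := (projT e tri_top).

(** The submodule that corresponds to the point [x]. *)
Definition ver_submod (x : 'rV[K]_n) : {vspace P} := point_submod ver_b (ver_u x) (ver_w x).

(** The planes of the moduli set are those of the points of [X]. *)
Lemma ver_moduliP C :
  (exists u w, [/\ u != 0, w != 0, C = point_submod ver_b u w
     & forall j, ver_b j u \in <[w]>%VS]) <->
  exists x, X x /\ C = ver_submod x.
Proof.
split=> [[u [w [u0 w0 -> buw]]]|[x [Xx ->]]]; last first.
  exists (ver_u x), (ver_w x); split=> //; [exact: ver_u_neq0 | exact: ver_w_neq0 | move=> j].
  apply/vlineP; exists (x 0 j); apply: val_inj; rewrite /= ver_bE.
  by rewrite val_ver_u // val_ver_w // contract_veronese.
(* The coordinates of the point are the factors of the [ver_b j u] along [w]. *)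
have [xj xjE] : exists xj : 'I_n -> K, forall j, ver_b j u = xj j *: w.
  by apply: (fin_all_exists (P := fun j c => ver_b j u = c *: w)) => j; apply/vlineP.
pose x := \row_j xj j; pose y := vsval u; pose z := vsval w.
have rank1 j : contract K E j y = x 0 j *: z by rewrite -ver_bE xjE mxE linearZ.
have yS j (t : E.-tuple 'I_n) : y [tuple of j :: t] = x 0 j * z t.
  by rewrite -contractE rank1 ffunE.
have tupleS (t : E.+1.-tuple 'I_n) : exists j (t' : E.-tuple 'I_n), t = [tuple of j :: t'].
  by exists (thead t), [tuple of behead t]; rewrite -tuple_eta.
have x0 : x != 0.
  apply: contraNneq u0 => x0; apply/eqP/val_inj => /=; apply/ffunP => t.
  by have [j [t' ->]] := tupleS t; rewrite yS x0 !mxE ffunE mul0r.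
have [c Ez] := veronese_of_rank1 x0 (ver_U_symmetric (subvsP u)) rank1.
have Ey : y = c *: veronese E.+1 x.
  apply/ffunP => t; have [j [t' ->]] := tupleS t.
  by rewrite yS Ez !ffunE big_cons; apply: mulrCA.
have c0 : c != 0.
  apply: contraNneq w0 => c0; apply/eqP/val_inj; rewrite /= -/z Ez c0.
  by rewrite scale0r.
have Xx : X x by apply: (ver_U_point x0 c0); rewrite -Ey subvsP.
exists x; split=> //.
have -> : u = c *: ver_u x by apply: val_inj; rewrite /= val_ver_u.
have -> : w = c *: ver_w x by apply: val_inj; rewrite /= val_ver_w.
by rewrite /ver_submod /point_submod !linearZ !line_eqZ.
Qed.

End VeroneseAlgebra.

(** * The isomorphism of varieties *)

Section VeroneseIso.
Variables (K : fieldType) (n : nat) (E : nat) (X : 'rV[K]_n -> Prop).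
Hypothesis X_neq0 : forall x, X x -> x != 0.
Hypothesis XZ : forall c x, c != 0 -> X x -> X (c *: x).
Variable gens : seq (tensor K n E.+1).
Hypothesis gens_span : forall u, (exists x, X x /\ u = veronese E.+1 x) -> u \in <<gens>>%VS.

Local Notation e := (tri_e (ver_b gens)).
Local Notation P := (projT e tri_top).
Local Notation M := #|{: incr_fun 2 (\dim {: P})}|.

(** The Pluecker vector of the submodule of [x]. *)
Definition ver_pluecker (x : 'rV[K]_n) : 'rV[K]_M :=
  plane_vec (embU (ver_b gens) (ver_u gens x)) (embW (ver_b gens) (ver_w gens x)).

Lemma ver_pluecker_pt x : X x ->
  pluecker_pt 2 (ver_submod gens x) = <[ver_pluecker x]>%VS.
Proof.
move=> Xx; apply: plane_pluecker_pt; apply: dim_point_submod.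
  exact: (ver_u_neq0 X_neq0 gens_span).
exact: (ver_w_neq0 X_neq0 gens_span).
Qed.

Lemma ver_plueckerZ c x : c != 0 -> <[ver_pluecker (c *: x)]>%VS = <[ver_pluecker x]>%VS.
Proof.
move=> c0; rewrite /ver_pluecker /ver_u /ver_w !veroneseZ !linearZ /=.
set y := embU _ _; set z := embW _ _.
have -> : plane_vec (c ^+ E.+1 *: y) (c ^+ E *: z) =
    plane_vec (c ^+ E.+1 *: y + 0 *: z) (0 *: y + c ^+ E *: z).
  by rewrite !scale0r addr0 add0r.
by rewrite plane_vec_comb mul0r subr0 line_eqZ // mulf_neq0 ?expf_neq0.
Qed.

Lemma ver_pluecker_poly : exists F : 'I_M -> {mpoly K[n]},
  forall j, F j \is (E.+1 + E).-homog /\ forall x, meval_row (F j) x = ver_pluecker x 0 j.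
Proof.
apply: (fin_all_exists (P := fun j (p : {mpoly K[n]}) => p \is (E.+1 + E).-homog /\
   forall x, meval_row p x = ver_pluecker x 0 j)) => j.
have coord_poly i : (exists2 p : {mpoly K[n]}, p \is E.+1.-homog &
      forall x, meval_row p x = coord (vbasis {: P}) i (embU (ver_b gens) (ver_u gens x))) /\
    exists2 p : {mpoly K[n]}, p \is E.-homog &
      forall x, meval_row p x = coord (vbasis {: P}) i (embW (ver_b gens) (ver_w gens x)).
  have hl : linear (fun y : P => coord (vbasis {: P}) i y : K^o).
    by move=> a y z; rewrite linearP.
  pose h : {linear P -> K^o} := HB.pack (fun y : P => coord (vbasis {: P}) i y : K^o)
    (GRing.isLinear.Build _ _ _ _ _ hl).
  split.
    have [p homp pE] := linear_form
      (linfun h \o embU (ver_b gens) \o linfun (vsproj (ver_U gens)))%VF.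
    by exists p => // x; rewrite pE comp_lfunE (lfunE (vsproj _)) comp_lfunE (lfunE h).
  have [p homp pE] := linear_form
      (linfun h \o embW (ver_b gens) \o linfun (vsproj (ver_W gens)))%VF.
  by exists p => // x; rewrite pE comp_lfunE (lfunE (vsproj _)) comp_lfunE (lfunE h).
have [[p0 homp0 p0E] [q0 homq0 q0E]] := coord_poly (val (enum_val j) 0).
have [[p1 homp1 p1E] [q1 homq1 q1E]] := coord_poly (val (enum_val j) 1).
exists (p0 * q1 - p1 * q0); split; first by rewrite rpredB // dhomogM.
move=> x; rewrite mxE /minor2 -p0E -p1E -q0E -q1E.
by rewrite /meval_row mevalB !mevalM.
Qed.

(** For each word [s] of length [E], linear forms in the Pluecker coordinates that
    give back the point [x] multiplied by the square of the monomial of [s]. *)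
Lemma ver_chart : exists c : E.-tuple 'I_n -> 'I_n -> 'rV[K]_M,
  forall s j x, X x -> \sum_i c s j 0 i * ver_pluecker x 0 i = veronese E x s ^+ 2 * x 0 j.
Proof.
have [c cE] : exists c : E.-tuple 'I_n * 'I_n -> 'rV[K]_M, forall sj, forall x, X x ->
    \sum_i c sj 0 i * ver_pluecker x 0 i = veronese E x sj.1 ^+ 2 * x 0 sj.2.
  apply: (fin_all_exists (P := fun (sj : E.-tuple 'I_n * 'I_n) (c : 'rV[K]_M) => forall x, X x ->
    \sum_i c 0 i * ver_pluecker x 0 i = veronese E x sj.1 ^+ 2 * x 0 sj.2)) => -[s j].
  have hl : linear (fun y : P => vsval (prU y) [tuple of j :: s] : K^o).
    by move=> a y z; rewrite !linearP !ffunE.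
  have hl' : linear (fun y : P => vsval (prW y) s : K^o).
    by move=> a y z; rewrite !linearP !ffunE.
  pose h : {linear P -> K^o} := HB.pack (fun y : P => vsval (prU y) [tuple of j :: s] : K^o)
    (GRing.isLinear.Build _ _ _ _ _ hl).
  pose h' : {linear P -> K^o} := HB.pack (fun y : P => vsval (prW y) s : K^o)
    (GRing.isLinear.Build _ _ _ _ _ hl').
  have [c cE] := plane_vec_functional (linfun h) (linfun h').
  have hE y : linfun h y = vsval (prU y) [tuple of j :: s] by rewrite lfunE.
  have h'E y : linfun h' y = vsval (prW y) s by rewrite lfunE.
  exists c => x Xx; rewrite cE !hE !h'E prU_embU prU_embW prW_embW prW_embU.
  rewrite (val_ver_u gens_span) // (val_ver_w X_neq0 gens_span) // veroneseS.
  have -> : vsval (0 : subvs_of (ver_W gens)) s = 0 by rewrite linear0 ffunE.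
  rewrite mulr0 subr0 /=; set v := veronese E x s.
  change (x 0 j * (v : K) * (v : K) = (v : K) ^+ 2 * x 0 j); ring.
by exists (fun s j => c (s, j)) => s j x; apply: cE.
Qed.

Variable V : {vspace 'rV[K]_n} -> Prop.
Hypothesis VX : forall l, V l <-> exists x, X x /\ l = <[x]>%VS.

Variable Y : {vspace 'rV[K]_M} -> Prop.
Hypothesis YX : forall l, Y l <-> exists x, X x /\ l = <[ver_pluecker x]>%VS.

(** The inverse map uses, at each point, a chart [s] whose value is nonzero; all
    such charts agree on [Y]. *)
Lemma ver_iso : variety_iso V Y.
Proof.
have [F FE] := ver_pluecker_poly; have [c cE] := ver_chart.
pose chart s (p : 'rV[K]_M) : 'rV[K]_n := \row_j \sum_i c s j 0 i * p 0 i.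
have chartE s a x : X x -> chart s (a *: ver_pluecker x) = (a * veronese E x s ^+ 2) *: x.
  move=> Xx; apply/rowP => j; rewrite !mxE -mulrA -cE // mulr_sumr.
  by apply: eq_bigr => i _; rewrite mxE mulrCA.
have chart_ex x : X x -> exists s, veronese E x s ^+ 2 != 0.
  move=> Xx; have /rV0Pn[i xi0] := X_neq0 Xx.
  by exists [tuple of nseq E i]; rewrite veronese_nseq !expf_neq0.
have pl_neq0 x : X x -> ver_pluecker x != 0.
  move=> Xx; have [s vs0] := chart_ex x Xx; apply: contraNneq (X_neq0 Xx) => pl0.
  have := chartE s 1 x Xx; rewrite pl0 scaler0 mul1r => chart0.
  have : veronese E x s ^+ 2 *: x == 0.
    by rewrite -chart0; apply/eqP/rowP => j; rewrite !mxE big1 // => i _; rewrite mxE mulr0.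
  by rewrite scaler_eq0 (negPf vs0).
pose f (l : {vspace 'rV[K]_n}) := <[ver_pluecker (vpick l)]>%VS.
pose g (l : {vspace 'rV[K]_M}) :=
  if [pick s | chart s (vpick l) != 0] is Some s then <[chart s (vpick l)]>%VS else 0%VS.
have fE x : x != 0 -> f <[x]>%VS = <[ver_pluecker x]>%VS.
  by move=> x0; rewrite /f; have [a a0 ->] := vpick_line x0; rewrite ver_plueckerZ.
have gE x : X x -> g <[ver_pluecker x]>%VS = <[x]>%VS.
  move=> Xx; rewrite /g; have [a a0 ->] := vpick_line (pl_neq0 x Xx).
  case: pickP => [s|chart0].
    by rewrite chartE // scaler_eq0 negb_or => /andP[as0 _]; rewrite line_eqZ.
  have [s vs0] := chart_ex x Xx; have := chart0 s.
  by rewrite chartE // scaler_eq0 (negPf (X_neq0 Xx)) orbF mulf_eq0 (negPf a0) (negPf vs0).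
exists f, g; split.
- split=> l => [/VX|/YX] [x [Xx ->]].
    by apply/YX; exists x; rewrite fE // X_neq0.
  by apply/VX; exists x; rewrite gE.
- split=> l => [/VX|/YX] [x [Xx ->]].
    by rewrite fE ?X_neq0 // gE.
  by rewrite gE // fE ?X_neq0.
- have polyE y : poly_map F y = ver_pluecker y.
    by apply/rowP => j; rewrite mxE; have [_ ->] := FE j.
  move=> x x0 /VX[x' [Xx' Ex]]; exists (E.+1 + E)%N, F; split.
  + by move=> j; have [] := FE j.
  + have [a a0 ->] := line_eqP x0 Ex; rewrite polyE.
    exact/pl_neq0/XZ.
  + by move=> y y0 _ _; rewrite polyE fE.
move=> p p0 /YX[x [Xx Ep]]; have [s vs0] := chart_ex x Xx.
pose G j : {mpoly K[M]} := \sum_i c s j 0 i *: 'X_i.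
have GE q : poly_map G q = chart s q.
  apply/rowP => j; rewrite !mxE /meval_row raddf_sum /=; apply: eq_bigr => i _.
  by rewrite mevalZ mevalXU.
exists 1%N, G; split.
- by move=> j; apply: rpred_sum => i _; apply: rpredZ; rewrite dhomogX /= mdeg1.
- have [a a0 ->] := line_eqP p0 Ep; rewrite GE chartE // scaler_eq0 negb_or X_neq0 // andbT.
  by rewrite mulf_neq0.
move=> q q0 /YX[y [Xy Eq]]; have [a a0 ->] := line_eqP q0 Eq; rewrite GE chartE //.
by rewrite scaler_eq0 negb_or => /andP[as0 _]; rewrite !line_eqZ // gE.
Qed.

End VeroneseIso.

Lemma homog_evalZ (K : fieldType) n D (p : {mpoly K[n]}) c (x : 'rV[K]_n) :
  p \is D.-homog -> meval_row p (c *: x) = c ^+ D * meval_row p x.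
Proof. by case/form_linear=> h hE; rewrite !hE veroneseZ linearZ. Qed.

(** The nonzero vectors of the cone over a projective set. *)
Lemma projective_points (K : fieldType) n (V : {vspace 'rV[K]_n} -> Prop) :
  projective_variety V -> exists X : 'rV[K]_n -> Prop,
  [/\ forall x, X x -> x != 0, forall c x, c != 0 -> X x -> X (c *: x),
      forall l, V l <-> exists x, X x /\ l = <[x]>%VS
    & forall x, x != 0 ->
      (forall p, vanishing_form X p -> meval_row p x = 0) -> X x].
Proof.
case=> S [homS VS]; exists (fun x => x != 0 /\ forall p, S p -> meval_row p x = 0); split.
- by move=> x [].
- move=> c x c0 [x0 Sx]; split; first by rewrite scaler_eq0 negb_or c0.
  by move=> p Sp; have [D homp] := homS p Sp; rewrite (homog_evalZ _ _ homp) Sx ?mulr0.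
- move=> l; split=> [/VS[x [x0 -> Sx]]|[x [[x0 Sx] ->]]]; first by exists x.
  by apply/VS; exists x.
move=> x x0 hx; split=> // p Sp; apply: hx; split; first exact: homS.
by move=> y [_]; apply.
Qed.

Lemma variety_iso_empty (K : fieldType) n m (V : {vspace 'rV[K]_n} -> Prop)
    (Y : {vspace 'rV[K]_m} -> Prop) :
  (forall l, ~ V l) -> (forall l, ~ Y l) -> variety_iso V Y.
Proof.
move=> V0 Y0; exists (fun=> 0%VS), (fun=> 0%VS).
split; first by split=> l => [/V0|/Y0].
- by split=> l => [/V0|/Y0].
- by move=> x _ /V0.
- by move=> x _ /Y0.
Qed.

Theorem mainTheorem5 (K : closedFieldType) (m : nat)
    (V : {vspace 'rV[K]_m.+1} -> Prop) (hV : projective_variety V) :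
  exists (Q : quiver) (I : path_algebra K Q -> Prop) (L : falgType K)
         (phi : {lrmorphism path_algebra K Q -> L}),
    [/\ admissible_ideal I, presents I phi
      & let e := fun i : 'I_(qvert Q).+1 => phi (qpath_elt K (qtriv i)) in
        exists (t d : 'I_(qvert Q).+1 -> nat),
          variety_iso V
            (pluecker_image (\dim {: projT e t} - \sum_i d i)%N (moduli_max e t d))].
Proof.
have [X [X0 XZ VX X_eqs]] := projective_points hV.
have [E hE] := equations_of_one_degree X.
have [gens [gensP gens_span]] := finite_span (fun u => exists x, X x /\ u = veronese E.+1 x).
pose b := ver_b gens.
pose Q := tri_quiver (\dim {: subvs_of (ver_U gens)}) m.+1.
have [phi phiE] := @path_lift K Q (tri b) _ _ (tri_e_orth b) (tri_e_sum b)
  (@tri_arr_src _ _ _ _ b).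
exists Q, (tri_ideal phi), (tri b), phi; split.
- exact: tri_ideal_admissible phiE.
- exact: tri_presents phiE (ver_b_full gens).
set e := fun i => _; have -> : e = tri_e b.
  by apply: functional_extensionality => i; rewrite /e phiE.
exists tri_top.
have [[x0 Xx0]|noX] := classic (exists x, X x); last first.
  (* For empty [V], a dimension vector that is too large for [P] makes the moduli
     set empty. *)
  exists (fun=> (\dim {: projT (tri_e b) tri_top}).+1).
  apply: variety_iso_empty => l; first by case/VX=> x [Xx _]; apply: noX; exists x.
  case=> C [[[dimC _ _ _] _] _ _]; move: dimC; rewrite !big_ord_recl; move/eqP; apply/negP.
  by rewrite neq_ltn addnCA addSn ltnS leq_addr orbT.
have dim_gt0 (vT : vectType K) (v : vT) : v != 0 -> (0 < \dim {: vT})%N.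
  move=> v0; rewrite lt0n dimv_eq0; apply: contraNneq v0 => full0.
  by rewrite -memv0 -full0 memvf.
have U0 := dim_gt0 _ _ (ver_u_neq0 X0 gens_span Xx0).
have W0 := dim_gt0 _ _ (ver_w_neq0 X0 gens_span Xx0).
exists (tri_dvec (subvs_of (ver_U gens)) (subvs_of (ver_W gens))).
have -> : (\dim {: projT (tri_e b) tri_top}
    - \sum_i tri_dvec (subvs_of (ver_U gens)) (subvs_of (ver_W gens)) i = 2)%N.
  by rewrite -(tri_dvec_sum b U0 W0) addKn.
apply: (ver_iso X0 XZ gens_span VX) => l.
have X_eqs' x : x != 0 -> (forall p : {mpoly K[m.+1]}, p \is E.+1.-homog ->
    (forall y, X y -> meval_row p y = 0) -> meval_row p x = 0) -> X x.
  by move=> x_n0 hx; apply: X_eqs => // p pX; apply: hE x_n0 hx p pX.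
split=> [[C [modC _ ->]]|[x [Xx ->]]].
  have /(ver_moduliP X0 X_eqs' gensP gens_span)[x [Xx ->]] := (tri_moduli_max U0 W0 C).1 modC.
  by exists x; split=> //; apply: (ver_pluecker_pt X0 gens_span).
exists (ver_submod gens x); split; last by rewrite (ver_pluecker_pt X0 gens_span).
  apply/(tri_moduli_max U0 W0)/(ver_moduliP X0 X_eqs' gensP gens_span).
  by exists x.
apply: dim_point_submod.
  exact: (ver_u_neq0 X0 gens_span).
exact: (ver_w_neq0 X0 gens_span).
Qed.
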